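(* Let $A\subseteq\{0,1\}^m$ with $|A|=n$. There is an algorithm that finds a hidden element $a\in A$ (using queries of the form ''what is $a_i$?'') in time $$\binom{m}{{\rm ETD}(A)}\cdot{\rm ETD}(A)\cdot n\log n$$ and asks at most $$\frac{2\cdot{\rm ETD}(A)\cdot\log n}{\log{\rm ETD}(A)}\le\frac{2\cdot\min({\rm ETD}(A),\log n)}{\log{\rm ETD}(A)}{\rm OPT}(A)$$ queries. In particular, if ${\rm ETD}(A)$ is constant then the algorithm is an $O(1)$-approximation algorithm (for the number of queries) that runs in polynomial time.
   Context: $\log$ denotes $\log_2$. For $h\in\{0,1\}^m$, a set $S\subseteq[m]$ is a specifying set for $h$ with respect to $A$ if at most one $a\in A$ satisfies $a_i=h_i$ for all $i\in S$; ${\rm ETD}(A,h)$ is the minimum size of such a set and ${\rm ETD}(A)=\max_{h\in\{0,1\}^m}{\rm ETD}(A,h)$. ${\rm OPT}(A)$ is the minimum, over all adaptive strategies, of the worst-case number of queries ''what is $a_i$?'' needed to identify a hidden $a\in A$; equivalently, the minimum depth of a decision tree for $A$ (a binary tree with internal nodes labeled by indices in $[m]$, edges labeled $0/1$, such that each $a\in A$ is the unique element of $A$ consistent with the answers along the path to its leaf). *)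

(* Defs.v *)
From mathcomp Require Import all_boot all_order all_algebra.
From mathcomp Require Import boolp reals exp.
Set Implicit Arguments.
Unset Strict Implicit.
Unset Printing Implicit Defensive.

Import Order.TTheory GRing.Theory Num.Theory.

Notation vec m := {ffun 'I_m -> bool}.

Definition log2 (R : realType) (x : R) : R := (ln x / ln 2)%R.

Definition specifying (m : nat) (A : {set vec m}) (h : vec m) (S : {set 'I_m})
  : bool :=
  #|[set a in A | [forall i in S, a i == h i]]| <= 1.

(* The arg min is a true minimum: [setT] is specifying, by [specifying_setT]. *)
Definition ETDh (m : nat) (A : {set vec m}) (h : vec m) : nat :=
  #|[arg min_(S < [set: 'I_m] | specifying A h S) #|S| ]|.

Definition ETD (m : nat) (A : {set vec m}) : nat :=
  \max_(h : vec m) ETDh A h.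

Lemma specifying_setT (m : nat) (A : {set vec m}) (h : vec m) :
  specifying A h [set: 'I_m].
Proof.
rewrite /specifying -(cards1 h); apply: subset_leq_card; apply/subsetP => a.
rewrite !inE => /andP[_ /forallP ah]; apply/eqP/ffunP => i.
by have := ah i; rewrite inE /= => /eqP.
Qed.

Inductive dtree (m : nat) : Type :=
| Leaf
| Node of 'I_m & dtree m & dtree m.  (* query, subtree for 0, subtree for 1 *)
Arguments Leaf {m}.

Fixpoint depth (m : nat) (t : dtree m) : nat :=
  if t is Node _ t0 t1 then (maxn (depth t0) (depth t1)).+1 else 0.

Fixpoint asked (m : nat) (t : dtree m) (a : vec m) : seq 'I_m :=
  if t is Node i t0 t1 then i :: asked (if a i then t1 else t0) a else [::].

Definition decides (m : nat) (A : {set vec m}) (t : dtree m) : Prop :=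
  forall a b : vec m, a \in A -> b \in A ->
    all (fun i => b i == a i) (asked t a) -> b = a.

Lemma decides_ex (m : nat) (A : {set vec m}) :
  exists k, `[< exists t : dtree m, decides A t /\ depth t = k >].
Proof.
pose t : dtree m := foldr (fun i u => Node i u u) Leaf (enum 'I_m).
exists (depth t); apply/asboolP; exists t; split=> // a b _ _ ab.
have askedE (s : seq 'I_m) :
    asked (foldr (fun i u => Node i u u) Leaf s) a = s.
  by elim: s => //= i s IHs; rewrite if_same IHs.
apply/ffunP => i; move: ab; rewrite /t askedE => /allP/(_ i).
by rewrite mem_enum => /(_ isT)/eqP.
Qed.

Definition OPT (m : nat) (A : {set vec m}) : nat := ex_minn (decides_ex A).

(* Running time is measured on a unit-cost random access machine, programmed in
   a structured language.  Memory consists of registers and of arrays, all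
   holding natural numbers.  Registers only grow by increments, so that after t
   steps no value exceeds the largest initial one by more than t: no work can be
   hidden in long words.  Programs are closed terms over this syntax, so a fixed
   program cannot depend on A other than through its inputs. *)

Inductive cmd : Type :=
| Clear of nat                     (* r_x := 0 *)
| Copy of nat & nat                (* r_x := r_y *)
| Incr of nat                      (* r_x := r_x + 1 *)
| Decr of nat                      (* r_x := r_x - 1, truncated at 0 *)
| Fetch of nat & nat & nat          (* r_x := b[r_y], arguments x, b, y *)
| Store of nat & nat & nat         (* b[r_y] := r_x, arguments b, y, x *)
| Input of nat & nat & nat         (* r_x := coordinate r_j of input row r_i *)
| Query of nat & nat               (* r_x := coordinate r_j of the hidden a *)
| Then of cmd & cmd
| IfLt of nat & nat & cmd & cmd    (* if r_x < r_y then .. else .. *)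
| WhileLt of nat & nat & cmd.      (* while r_x < r_y do .. *)

Record state : Type := State { reg : nat -> nat; arr : nat -> nat -> nat }.

Definition set_reg (s : state) (x v : nat) : state :=
  State (fun y => if y == x then v else reg s y) (arr s).

Definition set_arr (s : state) (b i v : nat) : state :=
  State (reg s)
        (fun c j => if (c == b) && (j == i) then v else arr s c j).

(* [exec inp hid c s s' t q]: on input matrix [inp] and hidden vector [hid], the
   command [c] started in [s] halts in [s'] after [t] steps and [q] queries.
   The relation is deterministic.  Every query, including a repeated one, is
   counted. *)
Inductive exec (inp : nat -> nat -> bool) (hid : nat -> bool) :
    cmd -> state -> state -> nat -> nat -> Prop :=
| EClear x s : exec inp hid (Clear x) s (set_reg s x 0) 1 0
| ECopy x y s : exec inp hid (Copy x y) s (set_reg s x (reg s y)) 1 0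
| EIncr x s : exec inp hid (Incr x) s (set_reg s x (reg s x).+1) 1 0
| EDecr x s : exec inp hid (Decr x) s (set_reg s x (reg s x).-1) 1 0
| EFetch x b y s :
    exec inp hid (Fetch x b y) s (set_reg s x (arr s b (reg s y))) 1 0
| EStore b y x s :
    exec inp hid (Store b y x) s (set_arr s b (reg s y) (reg s x)) 1 0
| EInput x i j s :
    exec inp hid (Input x i j) s (set_reg s x (inp (reg s i) (reg s j))) 1 0
| EQuery x j s :
    exec inp hid (Query x j) s (set_reg s x (hid (reg s j))) 1 1
| EThen c1 c2 s1 s2 s3 t1 t2 q1 q2 :
    exec inp hid c1 s1 s2 t1 q1 -> exec inp hid c2 s2 s3 t2 q2 ->
    exec inp hid (Then c1 c2) s1 s3 (t1 + t2) (q1 + q2)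
| EIfLt x y c1 c2 s s' t q :
    exec inp hid (if reg s x < reg s y then c1 else c2) s s' t q ->
    exec inp hid (IfLt x y c1 c2) s s' t.+1 q
| EWhileStop x y c s :
    ~~ (reg s x < reg s y) -> exec inp hid (WhileLt x y c) s s 1 0
| EWhileStep x y c s1 s2 s3 t1 t2 q1 q2 :
    reg s1 x < reg s1 y ->
    exec inp hid c s1 s2 t1 q1 -> exec inp hid (WhileLt x y c) s2 s3 t2 q2 ->
    exec inp hid (WhileLt x y c) s1 s3 (t1 + t2).+1 (q1 + q2).

(* Out-of-range coordinates read as 0. *)
Definition coord (m : nat) (v : vec m) (j : nat) : bool :=
  oapp (fun i : 'I_m => v i) false (insub j).

Definition rows (m : nat) (s : seq (vec m)) (i j : nat) : bool :=
  coord (nth [ffun=> false] s i) j.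

(* Registers 0, 1, 2 initially hold m, |A| and the auxiliary number e. *)
Definition start (m n e : nat) : state :=
  State (fun x => nth 0 [:: m; n; e] x) (fun _ _ => 0).

(* Program [P], given the list [s] of the elements of A and an auxiliary number
   [e], identifies the hidden element [a] of [s] in [t] steps and [q] queries.
   The answer, left in register 0, is the position of [a] in [s]. *)
Definition finds (m : nat) (P : cmd) (s : seq (vec m)) (e : nat) (a : vec m)
    (t q : nat) : Prop :=
  exists st : state,
    exec (rows s) (coord a) P (start m (size s) e) st t q /\
    reg st 0 = index a s.

(* Main.v *)
Require Import Defs.
From mathcomp Require Import all_boot all_order all_algebra.
From mathcomp Require Import reals exp.
From mathcomp Require Import zify lra.
Set Implicit Arguments.
Unset Strict Implicit.
Unset Printing Implicit Defensive.
Import Order.TTheory GRing.Theory Num.Theory.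

(* Let h be the majority vector of the remaining candidates and S a specifying
   set for h with k <= d = ETD A elements.  Query S greedily, always choosing
   the coordinate at which most candidates disagree with h, until an answer
   disagrees with h or one candidate is left.  The numbers of candidates removed
   by the agreeing answers decrease, so a phase of r queries divides the number
   of candidates by at least max(2, r): by 2 as h is a majority vector, and by r
   since a disagreeing answer keeps the smallest of r disjoint sets (and if all
   answers agree, each of the r queries removed a candidate).  As
   r log d <= 2 d log max(2, r) for 1 <= r <= d, the bound on the queries
   follows by summing over the phases, of which there are at most log n.
     The k-subsets are enumerated in colexicographic order, each step raising
   the rank, a sum of binomials, by one.  Counting the candidates with a given
   bit at each coordinate incrementally costs O(m n) in the whole run, which
   is at most C(m, k) k n, and makes each greedy choice cheap. *)

(** * Program logic *)

Fixpoint wreg (c : cmd) : seq nat :=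
  match c with
  | Clear x | Copy x _ | Incr x | Decr x | Fetch x _ _ | Input x _ _
  | Query x _ => [:: x]
  | Store _ _ _ => [::]
  | Then c1 c2 | IfLt _ _ c1 c2 => wreg c1 ++ wreg c2
  | WhileLt _ _ c => wreg c
  end.

Fixpoint warr (c : cmd) : seq nat :=
  match c with
  | Store b _ _ => [:: b]
  | Then c1 c2 | IfLt _ _ c1 c2 => warr c1 ++ warr c2
  | WhileLt _ _ c => warr c
  | _ => [::]
  end.

Record frame (c : cmd) (s s' : state) : Prop := Frame {
  freg : forall x, x \notin wreg c -> reg s' x = reg s x;
  farr : forall b, b \notin warr c -> arr s' b =1 arr s b }.

Section Logic.
Variables (inp : nat -> nat -> bool) (hid : nat -> bool).

(** Frame rule. For a concrete program, membership in [wreg] and [warr] is decided by computation,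
    so an invariant passes for free through code that does not write its registers and arrays. *)
Lemma exec_frame c s s' t q : exec inp hid c s s' t q -> frame c s s'.
Proof.
elim=> {c s s' t q}.
1-8: by move=> *; split=> [z|z] /=; rewrite ?inE // => /negPf zx *;
  rewrite ?zx.
- move=> c1 c2 s1 s2 s3 t1 t2 q1 q2 _ [r1 a1] _ [r2 a2].
  split=> [z|z]; rewrite /= mem_cat negb_or => /andP[z1 z2].
    by rewrite r2 // r1.
  by move=> l; rewrite a2 // a1.
- move=> x y c1 c2 s s' t q _ [r1 a1].
  split=> [z|z]; rewrite /= mem_cat negb_or => /andP[z1 z2].
    by apply: r1; case: ifP.
  by apply: a1; case: ifP.
- by [].
- move=> x y c s1 s2 s3 t1 t2 q1 q2 _ _ [r1 a1] _ [r2 a2].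
  by split=> [z zc|z zc l]; [rewrite r2 // r1 | rewrite a2 // a1].
Qed.

(** Total correctness: termination is part of the claim. As [exec] is deterministic, exhibiting one
    execution settles all of them. *)
Definition wp (c : cmd) (Q : state -> nat -> nat -> Prop) (s : state) : Prop :=
  exists s' t q, exec inp hid c s s' t q /\ Q s' t q.

Lemma wp_frame c Q s :
  wp c Q s -> wp c (fun s' t q => Q s' t q /\ frame c s s') s.
Proof.
move=> [s' [t [q [e Qs]]]]; exists s', t, q; split=> //; split=> //.
exact: exec_frame e.
Qed.

Lemma wp_mono c Q Q' s :
  wp c Q s -> (forall s' t q, frame c s s' -> Q s' t q -> Q' s' t q) ->
  wp c Q' s.
Proof.
move=> /wp_frame [s' [t [q [e [Qs fr]]]]] QQ'.
by exists s', t, q; split=> //; apply: QQ'.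
Qed.

Lemma wp_clear x Q s : Q (set_reg s x 0) 1 0 -> wp (Clear x) Q s.
Proof. by move=> ?; do 3!eexists; split; [constructor|]. Qed.
Lemma wp_copy x y Q s : Q (set_reg s x (reg s y)) 1 0 -> wp (Copy x y) Q s.
Proof. by move=> ?; do 3!eexists; split; [constructor|]. Qed.
Lemma wp_incr x Q s : Q (set_reg s x (reg s x).+1) 1 0 -> wp (Incr x) Q s.
Proof. by move=> ?; do 3!eexists; split; [constructor|]. Qed.
Lemma wp_decr x Q s : Q (set_reg s x (reg s x).-1) 1 0 -> wp (Decr x) Q s.
Proof. by move=> ?; do 3!eexists; split; [constructor|]. Qed.
Lemma wp_fetch x b y Q s :
  Q (set_reg s x (arr s b (reg s y))) 1 0 -> wp (Fetch x b y) Q s.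
Proof. by move=> ?; do 3!eexists; split; [constructor|]. Qed.
Lemma wp_store b y x Q s :
  Q (set_arr s b (reg s y) (reg s x)) 1 0 -> wp (Store b y x) Q s.
Proof. by move=> ?; do 3!eexists; split; [constructor|]. Qed.
Lemma wp_input x i j Q s :
  Q (set_reg s x (inp (reg s i) (reg s j))) 1 0 -> wp (Input x i j) Q s.
Proof. by move=> ?; do 3!eexists; split; [constructor|]. Qed.
Lemma wp_query x j Q s :
  Q (set_reg s x (hid (reg s j))) 1 1 -> wp (Query x j) Q s.
Proof. by move=> ?; do 3!eexists; split; [constructor|]. Qed.

Lemma wp_then c1 c2 Q s :
  wp c1 (fun s1 t1 q1 => wp c2 (fun s2 t2 q2 => Q s2 (t1 + t2) (q1 + q2)) s1) s ->
  wp (Then c1 c2) Q s.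
Proof.
move=> [s1 [t1 [q1 [e1 [s2 [t2 [q2 [e2 Qs]]]]]]]].
by exists s2, (t1 + t2), (q1 + q2); split=> //; apply: EThen e1 e2.
Qed.

Lemma wp_if x y c1 c2 Q s :
  (reg s x < reg s y -> wp c1 (fun s' t q => Q s' t.+1 q) s) ->
  (reg s y <= reg s x -> wp c2 (fun s' t q => Q s' t.+1 q) s) ->
  wp (IfLt x y c1 c2) Q s.
Proof.
move=> H1 H2; case: (ltnP (reg s x) (reg s y)) => [lt|ge].
  have [s' [t [q [e Qs]]]] := H1 lt.
  by exists s', t.+1, q; split=> //; constructor; rewrite lt.
have [s' [t [q [e Qs]]]] := H2 ge.
by exists s', t.+1, q; split=> //; constructor; rewrite ltnNge ge.
Qed.

(* Every iteration takes time, so a bound on the elapsed time [t] in the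
   invariant [I s t q] is all that termination needs. *)
Lemma wp_while (T : nat) (I : state -> nat -> nat -> Prop) x y c s :
  (forall s t q, I s t q -> t <= T) ->
  I s 0 0 ->
  (forall s1 t q, I s1 t q -> frame (WhileLt x y c) s s1 ->
     reg s1 x < reg s1 y ->
     wp c (fun s' t' q' => I s' (t + t').+1 (q + q')) s1) ->
  wp (WhileLt x y c)
     (fun s' t q => [/\ I s' t.-1 q, reg s' y <= reg s' x & 0 < t]) s.
Proof.
move=> IT I0 step.
suff H N s1 t q : T - t < N -> I s1 t q -> frame (WhileLt x y c) s s1 ->
    exists s' t' q', [/\ exec inp hid (WhileLt x y c) s1 s' t'.+1 q',
      I s' (t + t') (q + q') & reg s' y <= reg s' x].
  have [|s' [t [q [e Is le]]]] := H _ s 0 0 (ltnSn _) I0.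
    by split.
  by exists s', t.+1, q.
elim: N s1 t q => // N IHN s1 t q tN Is fr.
case: (ltnP (reg s1 x) (reg s1 y)) => [lt|ge]; last first.
  exists s1, 0, 0; rewrite !addn0; split=> //.
  by constructor; rewrite -leqNgt.
have [s2 [t2 [q2 [e2 I2]]]] := step _ _ _ Is fr lt.
have fr2 := exec_frame e2.
have [||s' [t' [q' [e' I' le]]]] := IHN s2 (t + t2).+1 (q + q2) _ I2.
- by have := IT _ _ _ Is; have := IT _ _ _ I2; lia.
- by case: fr fr2 => r1 a1 [r2 a2]; split=> [z zc|b bc l];
    [rewrite r2 // r1 | rewrite a2 // a1].
exists s', (t2 + t'.+1), (q2 + q'); split=> //.
- exact: EWhileStep lt e2 e'.
- by rewrite (addnA q) (_ : t + (t2 + t'.+1) = (t + t2).+1 + t'); [|lia].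
Qed.

Definition For x y c := Then (Clear x) (WhileLt x y (Then c (Incr x))).

(** Each round adds 2 steps to those of the body, for the test and the increment; the final [+ 2] is
    the initial [Clear] and the failing test. *)
Lemma wp_for (I : nat -> state -> nat -> Prop) x y c Q s :
  x != y -> x \notin wreg c -> y \notin wreg c ->
  I 0 (set_reg s x 0) 0 ->
  (forall i s1 t, I i s1 t -> frame (For x y c) s s1 -> reg s1 x = i ->
     i < reg s y ->
     wp c (fun s' t' q => I i.+1 (set_reg s' x i.+1) (t + t' + 2) /\ q = 0) s1) ->
  (forall s' t, frame (For x y c) s s' -> I (reg s y) s' t -> Q s' (t + 2) 0) ->
  wp (For x y c) Q s.
Proof.
move=> xy xc yc I0 step IQ; apply: wp_then; apply: wp_clear.
set N := reg s y; set s0 := set_reg s x 0.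
have yf : y \notin wreg (For x y c).
  by rewrite /= !(inE, mem_cat) (negPf yc) eq_sym (negPf xy).
suff H r i s1 t : N - i = r -> i <= N -> I i s1 t -> frame (For x y c) s s1 ->
    reg s1 x = i ->
    exists s' t', [/\ exec inp hid (WhileLt x y (Then c (Incr x))) s1 s' t'.+1 0,
      I N s' (t + t') & frame (For x y c) s s'].
  have [||s' [t' [e I' fr]]] := H _ _ s0 0 (erefl _) (leq0n _) I0.
  - split=> // z /=; rewrite inE negb_or /s0 /= => /andP[/negPf zx _].
    by rewrite zx.
  - by rewrite /= eqxx.
  by exists s', t'.+1, 0; split=> //; rewrite add1n -addn2; apply: IQ.
elim: r i s1 t => [|r IHr] i s1 t Nr iN Is fr rx.
  exists s1, 0; rewrite addn0; split=> //; last by have <- : i = N by lia.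
  by constructor; rewrite rx (freg fr yf) -/N -leqNgt; lia.
have iN' : i < N by lia.
have [s2 [t2 [q2 [e2 [I2 q20]]]]] := step _ _ _ Is fr rx iN'.
rewrite {}q20 in e2.
have fr2 := exec_frame e2; set s3 := set_reg s2 x i.+1.
have e3 : exec inp hid (Then c (Incr x)) s1 s3 (t2 + 1) (0 + 0).
  apply: EThen e2 _; have := EIncr inp hid x s2.
  by rewrite (freg fr2) // rx.
have fr3 : frame (For x y c) s s3.
  case: fr fr2 => r1 a1 [r2 a2]; split=> [z zc|b bc l].
    rewrite /s3 /=; have := zc; rewrite /= !(inE, mem_cat) !negb_or.
    by case/and3P=> /negPf -> z2 _; rewrite r2 ?r1 //= mem_cat negb_or z2.
  have /= := bc; rewrite !(mem_cat, cats0) => b2.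
  by rewrite /s3 /= a2 // a1.
have [|||s' [t' [e' I' fr']]] := IHr i.+1 s3 (t + t2 + 2) _ _ I2 fr3.
- lia.
- lia.
- by rewrite /s3 /= eqxx.
exists s', (t2 + t').+2; split=> //; last first.
  by rewrite (_ : t + (t2 + t').+2 = t + t2 + 2 + t'); [|lia].
have := @EWhileStep inp hid x y _ _ _ _ _ _ _ _ _ e3 e'.
rewrite rx (freg fr yf) iN' -/N !addn0 => /(_ isT).
by rewrite (_ : (t2 + 1 + t'.+1).+1 = (t2 + t').+3); [|lia].
Qed.

End Logic.

(** * Colexicographic enumeration of subsets *)

(* A k-subset of [0, m) is stored as f 0 < ... < f k.-1, with sentinel f k = m. *)
Definition comb (k m : nat) (f : nat -> nat) : Prop :=
  f k = m /\ forall p, p < k -> f p < f p.+1.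

(** Combinatorial number system: the position of the subset in colexicographic order. The sentinel
    contributes nothing. *)
Definition rank (k : nat) (f : nat -> nat) : nat := \sum_(p < k) 'C(f p, p.+1).

Lemma rankS k f : rank k.+1 f = rank k f + 'C(f k, k.+1).
Proof. exact: big_ord_recr. Qed.

Lemma eq_rank k f g : (forall p, p < k -> f p = g p) -> rank k f = rank k g.
Proof. by move=> fg; apply: eq_bigr => p _; rewrite fg. Qed.

Lemma comb_ge k m f p : comb k m f -> p <= k -> p <= f p.
Proof.
move=> [_ incf]; elim: p => // p IHp pk.
by apply: leq_ltn_trans (incf _ pk); apply/IHp/ltnW.
Qed.

Lemma comb_lt k m f p : comb k m f -> p < k -> f p < m.
Proof.
move=> [<- incf] pk; rewrite -(subnK pk) addnC.
have: p.+1 + (k - p.+1) <= k by lia.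
elim: (k - p.+1) => [|r IHr] le; first by rewrite addn0 incf.
by apply: ltn_trans (IHr _) _; rewrite ?addnS ?incf; lia.
Qed.

Lemma comb_id k m f : (forall p, p < k -> f p = p) -> f k = m -> k <= m -> comb k m f.
Proof.
move=> fid fk km; split=> // p pk; rewrite fid //.
by case: (ltnP p.+1 k) => ?; [rewrite fid | have ->: p.+1 = k by lia]; lia.
Qed.

Lemma rank_id k f : (forall p, p < k -> f p = p) -> rank k f = 0.
Proof. by move=> fid; apply: big1 => p _; rewrite fid // bin_small. Qed.

(** By induction the entries below the top one contribute less than C(f k, k), so Pascal's rule
    bounds the rank by C(f k + 1, k + 1). *)
Lemma rank_lt k m f : comb k m f -> rank k f < 'C(m, k).
Proof.
elim: k m => [|k IHk] m [fk incf]; first by rewrite /rank big_ord0 bin0.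
rewrite rankS; have lt: rank k f < 'C(f k, k).
  by apply: IHk; split=> // p pk; apply: incf; apply: ltnW.
apply: (@leq_trans 'C((f k).+1, k.+1)); first by rewrite binS; lia.
by apply: leq_bin2l; rewrite -fk incf.
Qed.

(** The rank determines the top entry: raising that entry outweighs, by [rank_lt], anything the
    smaller entries can contribute. Then induct. *)
Lemma rank_inj k m f g : comb k m f -> comb k m g -> rank k f = rank k g ->
  forall p, p < k -> f p = g p.
Proof.
elim: k m => // k IHk m cf cg; rewrite !rankS => eqr.
have sub h : comb k.+1 m h -> comb k (h k) h.
  by move=> [_ inch]; split=> // p pk; apply: inch; apply: ltnW.
have aux h h' : comb k.+1 m h -> rank k h + 'C(h k, k.+1) = rank k h' + 'C(h' k, k.+1) ->
    h' k <= h k.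
  move=> ch e; rewrite leqNgt; apply/negP => lt.
  have := rank_lt (sub _ ch); have := leq_bin2l k.+1 lt; rewrite binS; lia.
have fgk : f k = g k.
  by apply/eqP; rewrite eqn_leq (aux g f) // (aux f g).
have := IHk _ (sub f cf); rewrite fgk in eqr * => /(_ (sub g cg)) H p.
rewrite ltnS leq_eqVlt => /predU1P[-> //|]; apply: H; lia.
Qed.

(** Hockey-stick identity. It serves twice: for the entries reset in a successor step, and with
    [p = k] for the last subset. *)
Lemma rank_run p f : (forall q, q < p -> f q.+1 = (f q).+1) -> (rank p f).+1 = 'C(f p, p).
Proof.
elim: p => [_|p IHp run]; first by rewrite /rank big_ord0 bin0.
have /IHp e : forall q, q < p -> f q.+1 = (f q).+1 by move=> q qp; apply/run/ltnW.
by rewrite rankS run // binS -e; lia.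
Qed.

(** Resetting the run below [p] loses C(f p, p) - 1 by [rank_run], and raising entry [p] gains C(f
    p, p) by Pascal's rule; the entries above contribute the same to both ranks. *)
Lemma rank_next k m f g p :
  comb k m f -> p < k -> (forall q, q < p -> f q.+1 = (f q).+1) ->
  (f p).+1 < f p.+1 ->
  (forall q, q < p -> g q = q) -> g p = (f p).+1 ->
  (forall q, p < q -> g q = f q) ->
  comb k m g /\ rank k g = (rank k f).+1.
Proof.
move=> cf pk run lt g_lt gp g_gt; have [fk incf] := cf; split.
  split=> [|q qk]; first by rewrite g_gt.
  case: (ltngtP q p) => [qp|pq|->].
  - rewrite (g_lt q qp); case: (ltngtP q.+1 p) => [qp'|pq'|->].
    + by rewrite g_lt.
    + by lia.
    + by rewrite gp; have := comb_ge cf (ltnW pk); lia.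
  - by rewrite !g_gt ?incf //; lia.
  - by rewrite gp g_gt.
rewrite -(subnKC pk); elim: (k - p.+1) => [|r IHr].
  by rewrite addn0 !rankS rank_id // gp binS add0n -(rank_run run); lia.
rewrite addnS (rankS _ g) (rankS _ f) IHr addSn g_gt //; lia.
Qed.

(** * Counting the positions below n that satisfy a predicate *)

Section CountBelow.
Variable n : nat.
(** Sets of candidates are predicates on positions in the input list, as the program sees them;
    their values from [n] on do not matter. *)
Definition count_below (P : pred nat) : nat := count P (iota 0 n).

Lemma eq_count_below (P Q : pred nat) :
  (forall i, i < n -> P i = Q i) -> count_below P = count_below Q.
Proof. by move=> PQ; apply: eq_in_count => i; rewrite mem_iota; apply: PQ. Qed.

Lemma count_below_le (P Q : pred nat) :
  (forall i, i < n -> P i -> Q i) -> count_below P <= count_below Q.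
Proof.
move=> PQ; rewrite (eq_count_below (Q := predI P Q)) /count_below.
  by apply: sub_count => i /andP[].
by move=> i ilt /=; case Pi: (P i) => //; rewrite PQ.
Qed.

Lemma count_below0 : count_below (fun=> false) = 0.
Proof. exact: count_pred0. Qed.

Lemma count_below_max P : count_below P <= n.
Proof. by rewrite -[leqRHS](size_iota 0 n); apply: count_size. Qed.

Lemma count_below_split (P Q : pred nat) :
  count_below P =
    count_below (fun i => P i && Q i) + count_below (fun i => P i && ~~ Q i).
Proof.
rewrite /count_below; elim: (iota 0 n) => //= i r ->.
by case: (P i); case: (Q i); lia.
Qed.

Lemma count_below_rem (P : pred nat) i : i < n -> P i ->
  count_below P = (count_below (fun j => P j && (j != i))).+1.
Proof.
move=> ilt Pi; rewrite (count_below_split P (pred1 i)) -[RHS]add1n; congr (_ + _).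
rewrite /count_below (eq_count (a2 := pred1 i)).
  by rewrite count_uniq_mem ?iota_uniq ?mem_iota ?ilt.
by move=> j /=; case: eqP => [->|]; rewrite ?Pi ?andbF.
Qed.

Lemma count_below_gt0 (P : pred nat) i : i < n -> P i -> 0 < count_below P.
Proof. by move=> ilt Pi; rewrite (count_below_rem ilt Pi). Qed.

Lemma count_below_eq1 (P : pred nat) i j :
  count_below P = 1 -> i < n -> j < n -> P i -> P j -> i = j.
Proof.
move=> P1 ilt jlt Pi Pj; apply/eqP/negPn/negP => ij.
have := count_below_rem ilt Pi; rewrite P1 => -[] /esym.
have := @count_below_gt0 (fun j => P j && (j != i)) j jlt.
by rewrite Pj eq_sym ij => /(_ isT); lia.
Qed.

(** [up] selects insertion, used during initialisation, or deletion, used after an answer; one proof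
    serves both. *)
Definition flip_to (up : bool) (al : pred nat) i : pred nat :=
  fun j => if j == i then up else al j.

Definition upd (up : bool) (x : nat) := if up then x.+1 else x.-1.

Lemma count_below_flip up (al P : pred nat) i : i < n -> al i = ~~ up ->
  count_below (fun j => flip_to up al i j && P j) =
    let c := count_below (fun j => al j && P j) in if P i then upd up c else c.
Proof.
rewrite /flip_to => ilt ali; case Pi: (P i); last first.
  by apply: eq_count_below => j _; case: eqP => // ->; rewrite Pi !andbF.
case: up ali => ali /=.
  rewrite (count_below_rem (i := i)) ?eqxx //; congr S; apply: eq_count_below => j _.
  by case: eqP => [->|]; rewrite ?ali ?andbF ?andbT.
rewrite [in RHS](count_below_rem (i := i)) ?ali //=; apply: eq_count_below => j _.
by case: eqP => [->|]; rewrite ?andbF ?andbT.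
Qed.

End CountBelow.

(** * The program *)

Notation rM := 0 (only parsing).
Notation rN := 1 (only parsing).
Notation rK := 2 (only parsing).
Notation rOne := 3 (only parsing).
Notation rZero := 4 (only parsing).
Notation rI := 5 (only parsing).
Notation rJ := 6 (only parsing).
Notation rX := 7 (only parsing).
Notation rY := 8 (only parsing).
Notation rCnt := 9 (only parsing).
Notation rP := 10 (only parsing).
Notation rJq := 11 (only parsing).
Notation rBest := 12 (only parsing).
Notation rBit := 13 (only parsing).
Notation rFound := 14 (only parsing).
Notation rLim := 15 (only parsing).
Notation rFlag := 16 (only parsing).
Notation rHits := 17 (only parsing).
Notation rGo := 18 (only parsing).

(* [aOne] and [aZero] count, for each coordinate, the remaining candidates with
   bit 1 and bit 0 there; [aMaj] is the majority vector of the current phase. *)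
Notation aAlive := 0 (only parsing).
Notation aOne := 1 (only parsing).
Notation aZero := 2 (only parsing).
Notation aMaj := 3 (only parsing).
Notation aSet := 4 (only parsing).

Declare Scope cmd_scope.
Delimit Scope cmd_scope with cmd.
Notation "c1 ;; c2" := (Then c1 c2) (at level 60, right associativity) : cmd_scope.
Bind Scope cmd_scope with cmd.
Local Open Scope cmd_scope.

(** No command is a no-op, so one step is spent on the scratch register. *)
Definition Skip := Clear rX.
Definition Bump (up : bool) x := if up then Incr x else Decr x.
Definition IfNeq x y c := IfLt x y c (IfLt y x c Skip).

Definition Tally up b := Fetch rY b rJ ;; Bump up rY ;; Store b rJ rY.

(** [rOne] and [rZero] hold the constants 1 and 0. A change of status costs O(m), and each candidate
    changes status at most twice in a run. *)
Definition SetAlive up :=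
  Store aAlive rI (if up then rOne else rZero) ;; Bump up rCnt ;;
  For rJ rM (Input rX rI rJ ;; IfLt rZero rX (Tally up aOne) (Tally up aZero)).

Definition Init := For rI rN (SetAlive true).

Definition Kill :=
  For rI rN
    (Fetch rX aAlive rI ;;
     IfLt rZero rX
       (Input rX rI rJq ;; IfNeq rX rBit (SetAlive false))
       Skip).

Definition Majority :=
  For rJ rM
    (Fetch rX aZero rJ ;; Fetch rY aOne rJ ;;
     IfLt rX rY (Store aMaj rJ rOne) (Store aMaj rJ rZero)).

Definition FirstSet := For rP rK (Store aSet rP rP) ;; Store aSet rK rM.

(** All rows are counted, eliminated ones included, so an accepted set is specifying for the whole
    of A. *)
Definition Check :=
  Clear rHits ;;
  For rI rN
    (Copy rFlag rOne ;;
     For rP rK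
       (Fetch rJ aSet rP ;; Input rX rI rJ ;; Fetch rY aMaj rJ ;;
        IfNeq rX rY (Clear rFlag)) ;;
     IfLt rZero rFlag (Incr rHits) Skip).

(* Colexicographic successor: raise the first entry that has room and reset the
   smaller ones; [rLim] becomes 0, or stays k when there is no successor. *)
Definition NextSet :=
  Clear rP ;; Copy rLim rK ;;
  WhileLt rP rLim
    (Fetch rX aSet rP ;; Incr rX ;; Copy rY rP ;; Incr rY ;; Fetch rY aSet rY ;;
     IfLt rX rY (Store aSet rP rX ;; Clear rLim) (Store aSet rP rP ;; Incr rP)).

(** [rK] is not reset between phases: the search resumes at the size reached before and never
    returns to a smaller one. *)
Definition Search :=
  FirstSet ;; Clear rFound ;;
  WhileLt rFound rOne
    (Check ;;
     IfLt rOne rHits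
       (NextSet ;; IfLt rZero rLim (Incr rK ;; FirstSet) Skip)
       (Copy rFound rOne)).

Definition Choose :=
  Clear rBest ;;
  For rP rK
    (Fetch rJ aSet rP ;; Fetch rX aMaj rJ ;;
     IfLt rZero rX (Fetch rY aZero rJ) (Fetch rY aOne rJ) ;;
     IfLt rBest rY (Copy rBest rY ;; Copy rJq rJ) Skip).

(* [rGo] repeats the number of candidates, but is 0 after an answer that
   disagrees with the majority. *)
Definition Ask :=
  Choose ;; Query rBit rJq ;; Kill ;;
  Fetch rX aMaj rJq ;; Copy rGo rCnt ;; IfNeq rX rBit (Clear rGo).

Definition Phase := Majority ;; Search ;; Copy rGo rCnt ;; WhileLt rOne rGo Ask.

Definition Output := For rI rN (Fetch rX aAlive rI ;; IfLt rZero rX (Copy 0 rI) Skip).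

(** [rZero] keeps its initial value 0. The first size is max(e, 1); with fewer than two rows the
    answer is position 0 at once. *)
Definition Learn :=
  Clear rOne ;; Incr rOne ;;
  IfLt rOne rN
    (IfLt rK rOne (Copy rK rOne) Skip ;; Init ;; WhileLt rOne rCnt Phase ;; Output)
    (Clear 0).

Ltac wp_step :=
  match goal with
  | |- wp _ _ (Then _ _) _ _ => apply: wp_then
  | |- wp _ _ (Clear _) _ _ => apply: wp_clear
  | |- wp _ _ Skip _ _ => apply: wp_clear
  | |- wp _ _ (Copy _ _) _ _ => apply: wp_copy
  | |- wp _ _ (Incr _) _ _ => apply: wp_incr
  | |- wp _ _ (Decr _) _ _ => apply: wp_decr
  | |- wp _ _ (Fetch _ _ _) _ _ => apply: wp_fetch
  | |- wp _ _ (Store _ _ _) _ _ => apply: wp_store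
  | |- wp _ _ (Input _ _ _) _ _ => apply: wp_input
  | |- wp _ _ (Query _ _) _ _ => apply: wp_query
  end; cbn beta.
Ltac wp_run := repeat wp_step.

(** * Correctness and running time *)

Section Correctness.
Variables (inp : nat -> nat -> bool) (hid : nat -> bool) (m n : nat).
Local Notation wp := (wp inp hid).
Local Notation tot := (count_below n).

Definition ctx (s : state) : Prop :=
  [/\ reg s rM = m, reg s rN = n, reg s rOne = 1 & reg s rZero = 0].

Lemma frame_ctx c s s' : frame c s s' ->
  ~~ has (fun x => x \in [:: rM; rN; rOne; rZero]) (wreg c) -> ctx s -> ctx s'.
Proof.
move=> [fr _] /hasPn Hc [s0 s1 s3 s4].
by split; rewrite fr //; apply/negP => /Hc.
Qed.

Lemma wp_neq x y c Q s :
  (reg s x <> reg s y -> forall t0, t0 <= 2 ->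
     wp c (fun s' t q => Q s' (t0 + t) q) s) ->
  (reg s x = reg s y -> Q (set_reg s rX 0) 3 0) ->
  wp (IfNeq x y c) Q s.
Proof.
move=> neq eq; apply: wp_if => [lt|le].
  by apply: (neq _ 1) => //; lia.
apply: wp_if => [lt|ge]; first by apply: (neq _ 2) => //; lia.
by apply: wp_clear; apply: eq; lia.
Qed.

Definition tab (al : pred nat) (s : state) : Prop :=
  [/\ forall i, i < n -> arr s aAlive i = al i,
      reg s rCnt = tot al &
      forall j, j < m ->
        arr s aOne j = tot (fun i => al i && inp i j) /\
        arr s aZero j = tot (fun i => al i && ~~ inp i j)].

Lemma eq_tab al al' s : (forall i, i < n -> al i = al' i) -> tab al s -> tab al' s.
Proof.
move=> e [sal scnt st]; split=> [i ilt||j jlt].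
- by rewrite sal // e.
- by rewrite scnt; apply: eq_count_below.
- by have [-> ->] := st j jlt; split; apply: eq_count_below => i ilt; rewrite e.
Qed.

Lemma frame_tab c al s s' : frame c s s' ->
  rCnt \notin wreg c ->
  ~~ has (fun x => x \in [:: aAlive; aOne; aZero]) (warr c) ->
  tab al s -> tab al s'.
Proof.
move=> [fr fa] cc /hasPn Hc [sal scnt st]; split=> [i ilt||j jlt].
- by rewrite fa ?sal //; apply/negP => /Hc.
- by rewrite fr.
- by rewrite !fa; [exact: st| |]; apply/negP => /Hc.
Qed.

Lemma wp_SetAlive up al s :
  ctx s -> tab al s -> reg s rI < n -> al (reg s rI) = ~~ up ->
  wp (SetAlive up)
     (fun s' t q => [/\ tab (flip_to up al (reg s rI)) s', t <= 7 * m + 4 & q = 0]) s.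
Proof.
move=> [sM sN sO sZ] [sal scnt st] ilt ali; set i := reg s rI.
have loop s1 : reg s1 rM = m -> reg s1 rI = i -> reg s1 rZero = 0 ->
   wp (For rJ rM (Input rX rI rJ ;; IfLt rZero rX (Tally up aOne) (Tally up aZero)))
    (fun s' t q => [/\ forall j, j < m ->
       arr s' aOne j =
         (if inp i j then upd up (arr s1 aOne j) else arr s1 aOne j) /\
       arr s' aZero j =
         (if ~~ inp i j then upd up (arr s1 aZero j) else arr s1 aZero j),
       t <= 7 * m + 2 & q = 0]) s1.
  move=> s1M s1I s1Z.
  pose I l s' t := (forall j, j < m ->
       arr s' aOne j =
         (if (j < l) && inp i j then upd up (arr s1 aOne j) else arr s1 aOne j) /\
       arr s' aZero j =
         (if (j < l) && ~~ inp i j then upd up (arr s1 aZero j)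
          else arr s1 aZero j)) /\ t <= 7 * l.
  apply: (@wp_for inp hid I) => //.
  - by case: (up).
  - by case: (up).
  - move=> l s2 t [st2 tl] fr s2J llt.
    have s2I : reg s2 rI = i by rewrite (freg fr) //; case: (up).
    have s2Z : reg s2 rZero = 0 by rewrite (freg fr) //; case: (up).
    wp_run; apply: wp_if; rewrite /= s2I s2J s2Z => inpl;
      rewrite /Tally /Bump /I; case: (up) st2 => st2; wp_run => /=; rewrite s2J;
      (split; last by []); (split; last by lia) => j jm /=;
      have [eO eZ] := st2 j jm; rewrite eO eZ ?(ltnS j l) (leq_eqVlt j l);
      case: (eqVneq j l) => [jl|_] //=;
      rewrite jl in eO eZ *; move: eO eZ; rewrite ltnn /=;
      by case: (inp i l) inpl => //= _ eO eZ; rewrite ?eO ?eZ.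
  move=> s' t _ [st' tl]; split=> //; last by rewrite s1M in tl; lia.
  by move=> j jm; have := st' j jm; rewrite s1M jm.
have := ilt; rewrite -/i => iltn.
apply: wp_then; wp_run; cbn beta.
have fin s1 : reg s1 rM = m -> reg s1 rI = i -> reg s1 rZero = 0 ->
   reg s1 rCnt = upd up (tot al) ->
   (forall j, arr s1 aAlive j = if j == i then up : nat else arr s aAlive j) ->
   (forall j, arr s1 aOne j = arr s aOne j) ->
   (forall j, arr s1 aZero j = arr s aZero j) ->
   wp (For rJ rM (Input rX rI rJ ;; IfLt rZero rX (Tally up aOne) (Tally up aZero)))
     (fun s' t q => [/\ tab (flip_to up al i) s', 1 + (1 + t) <= 7 * m + 4 &
        0 + (0 + q) = 0]) s1.
  move=> s1M s1I s1Z s1C s1A s1O s1Ze; apply: wp_mono (loop s1 s1M s1I s1Z) _.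
  move=> s' t q fr [st' tl ->]; split=> //; last by lia.
  split=> [j jlt||j jm].
  - rewrite (farr fr); last by case: (up).
    by rewrite s1A /flip_to; case: eqP => // _; rewrite sal.
  - rewrite (freg fr); last by case: (up).
    rewrite s1C; have := @count_below_flip n up al predT i ilt ali; rewrite /=.
    have e P : tot (fun j => P j && true) = tot P by apply: eq_count_below => j; rewrite andbT.
    by rewrite !e => ->.
  - have [-> ->] := st' j jm; rewrite s1O s1Ze; have [-> ->] := st j jm.
    by rewrite !count_below_flip.
rewrite /Bump; case: (up) fin ali => fin ali; wp_run; apply: fin => //=.
- by rewrite scnt.
- by move=> j; rewrite sO.
- by rewrite scnt.
- by move=> j; rewrite sZ.
Qed.

Lemma wp_Init s : ctx s -> tab (fun=> false) s ->
  wp Init (fun s' t q => [/\ tab predT s', t <= n * (7 * m + 6) + 2 & q = 0]) s.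
Proof.
move=> cs ts.
pose I i s' t := tab (fun i' => i' < i) s' /\ t <= i * (7 * m + 6).
have [_ sN _ _] := cs.
apply: (@wp_for inp hid I) => //.
- move=> i s1 t [ts1 tl] fr s1I; rewrite sN => iltn.
  have := @wp_SetAlive true (fun i' => i' < i) s1 (frame_ctx fr isT cs) ts1.
  rewrite s1I => /(_ iltn); rewrite ltnn => /(_ erefl)/wp_mono; apply.
  move=> s2 t2 q _ [ts2 t2l ->]; split=> //; split; last by lia.
  apply: eq_tab ts2 => j _; rewrite /flip_to (ltnS j i) (leq_eqVlt j i).
  by case: eqP.
move=> s' t _ [ts' tl]; rewrite sN in ts' tl.
by split=> //; [apply: eq_tab ts' => i -> | lia].
Qed.

(** Amortised bound: 7 m + 10 times the number of candidates is a potential that pays for the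
    removals, leaving O(n) per query. *)
Lemma wp_Kill s al jq (b : bool) :
  ctx s -> tab al s -> reg s rJq = jq -> reg s rBit = b ->
  wp Kill (fun s' t q => [/\ tab (fun i => al i && (inp i jq == b)) s',
     t + (7 * m + 10) * tot (fun i => al i && (inp i jq == b)) <=
       12 * n + 2 + (7 * m + 10) * tot al & q = 0]) s.
Proof.
move=> cs ts sJ sB; have [_ sN _ _] := cs.
(* The candidates that remain once the rows below [i] have been processed. *)
pose al_ i i' := al i' && ((i' < i) ==> (inp i' jq == b)).
have al_n i : i < n -> al_ n i = al i && (inp i jq == b).
  by move=> lt; rewrite /al_ lt.
pose I i s' t := tab (al_ i) s' /\
  t + (7 * m + 10) * tot (al_ i) <= 12 * i + (7 * m + 10) * tot al.
apply: (@wp_for inp hid I) => //.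
- split; last first.
    rewrite muln0 leq_add2l leq_mul2l count_below_le ?orbT //.
    by move=> i _ /andP[].
  by apply: eq_tab ts => i _; rewrite /al_ andbT.
- move=> i s1 t [ts1 tl] fr s1I; rewrite sN => iltn.
  have cs1 := frame_ctx fr isT cs; have [s1M s1N s1O s1Z] := cs1.
  have s1J : reg s1 rJq = jq by rewrite (freg fr).
  have s1B : reg s1 rBit = b by rewrite (freg fr).
  have al_S j : j != i -> al_ i.+1 j = al_ i j.
    by move=> ji; rewrite /al_ (ltnS j i) (leq_eqVlt j i) (negPf ji).
  have al_i : al_ i i = al i by rewrite /al_ ltnn andbT.
  have al_Si : al_ i.+1 i = al i && (inp i jq == b) by rewrite /al_ leqnn.
  (* Covers the rows that change nothing: those already eliminated and those agreeing with the
     answer. *)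
  have skip s2 t' : al_ i.+1 i = al_ i i -> reg s2 rCnt = reg s1 rCnt ->
      (forall b j, arr s2 b j = arr s1 b j) -> t' <= 12 ->
      I i.+1 (set_reg s2 rI i.+1) (t + t').
    move=> e eC eA t'l.
    have e' j : al_ i j = al_ i.+1 j by case: (eqVneq j i) => [->|/al_S].
    have et : tot (al_ i) = tot (al_ i.+1) by apply: eq_count_below => j _.
    split; last by rewrite -et; lia.
    apply: (@eq_tab (al_ i)) => //.
    have [A1 A2 A3] := ts1; split=> [j jn||j jm] /=; rewrite ?eA ?eC; by auto.
  have [sal _ _] := ts1.
  wp_run; apply: wp_if; rewrite /= s1Z s1I sal //;
    case ali: (al_ i i) => // _; last first.
    wp_run; split=> //; rewrite -addnA; apply: skip => //.
    by rewrite al_Si; move: ali; rewrite al_i => ->.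
  wp_run; apply: wp_neq; rewrite /= s1J s1I s1B; last first.
    move=> e; split=> //; rewrite -addnA; apply: skip => //.
    by rewrite al_Si al_i; case: (inp i jq) (b) e => -[] //; rewrite andbT.
  move=> ne t0 t0l.
  have := @wp_SetAlive false (al_ i).
  move=> /(_ (set_reg (set_reg s1 7 (al_ i i)) 7 (inp i jq))).
  rewrite /= s1I ali => /(_ cs1 ts1 iltn erefl)/wp_mono; apply.
  move=> s2 t2 q _ [ts2 t2l ->]; split=> //.
  have nal : al_ i.+1 i = false.
    by rewrite al_Si; case: (inp i jq) (b) ne => -[] //; rewrite andbF.
  split.
    apply: eq_tab ts2 => j _; rewrite /flip_to.
    by case: eqVneq => [->|/al_S //]; rewrite nal.
  have e : tot (al_ i) = (tot (al_ i.+1)).+1.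
    rewrite (@count_below_rem _ _ i) //; congr S; apply: eq_count_below => j _.
    by case: (eqVneq j i) => [->|/al_S ->]; rewrite ?nal ?andbF ?andbT.
  move: tl; rewrite e; nia.
move=> s' t _ [ts' tl]; rewrite sN in ts' tl.
rewrite (eq_count_below (Q := al_ n)); last by move=> i /al_n.
split=> //; last by lia.
exact: eq_tab ts'.
Qed.

(** A tie gives bit 0; [dis_maj] holds for either choice. *)
Definition maj (al : pred nat) j :=
  tot (fun i => al i && ~~ inp i j) < tot (fun i => al i && inp i j).

Lemma wp_Majority s al : ctx s -> tab al s ->
  wp Majority (fun s' t q => [/\ forall j, j < m -> arr s' aMaj j = maj al j,
    t <= 6 * m + 2 & q = 0]) s.
Proof.
move=> cs ts; have [sM _ _ _] := cs.
pose I l s' t := (forall j, j < l -> arr s' aMaj j = maj al j) /\ t <= 6 * l.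
apply: (@wp_for inp hid I) => //.
- move=> l s1 t [s1H tl] fr s1J; rewrite sM => llt.
  have [s1M s1N s1O s1Z] := frame_ctx fr isT cs.
  have [_ _ /(_ l llt)[eO eZ]] := frame_tab fr isT isT ts.
  wp_run; apply: wp_if; rewrite /= s1J eO eZ => c; wp_run => /=;
    split=> //; (split=> /=; last by lia) => j; rewrite s1J ltnS leq_eqVlt;
    case: (eqVneq j l) => [-> _|_ /s1H //] /=;
    by rewrite ?s1O ?s1Z /maj ltnNge ?c // -ltnNge c.
move=> s' t _ [st' tl]; rewrite sM in st' tl; split=> //; lia.
Qed.

(** * The search for a specifying set *)

Lemma wp_FirstSet s k : reg s rK = k -> reg s rM = m ->
  wp FirstSet (fun s' t q => [/\ forall p, p < k -> arr s' aSet p = p,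
    arr s' aSet k = m, t <= 3 * k + 3 & q = 0]) s.
Proof.
move=> sK sM; apply: wp_then.
pose I l s' t := (forall p, p < l -> arr s' aSet p = p) /\ t <= 3 * l.
apply: (@wp_for inp hid I) => //.
- move=> l s1 t [s1S tl] fr s1P; rewrite sK => llt.
  wp_run; rewrite /= s1P; split=> //; split=> /=; last by lia.
  move=> p; rewrite ltnS leq_eqVlt.
  by case: (eqVneq p l) => [-> _|_ /s1S].
move=> s' t fr [st' tl]; rewrite sK in st' tl.
have s'K : reg s' rK = k by rewrite (freg fr).
have s'M : reg s' rM = m by rewrite (freg fr).
wp_run; rewrite /= s'K s'M eqxx; split=> //; last by lia.
by move=> p pk; rewrite (ltn_eqF pk); apply: st'.
Qed.

(** That [f] is specifying for [h] reads [tot (hit h k f) <= 1]. *)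
Definition hit (h : pred nat) k (f : nat -> nat) : pred nat :=
  fun i => all (fun p => inp i (f p) == h (f p)) (iota 0 k).

Lemma hitS h k f i : hit h k.+1 f i = hit h k f i && (inp i (f k) == h (f k)).
Proof. by rewrite /hit -addn1 iotaD all_cat /= andbT. Qed.

Lemma eq_hit h k f g : (forall p, p < k -> f p = g p) -> hit h k f =1 hit h k g.
Proof. by move=> fg i; apply: eq_in_all => p; rewrite mem_iota => /fg ->. Qed.

Lemma wp_Check s h k f : ctx s -> reg s rK = k ->
  (forall j, j < m -> arr s aMaj j = (h j : bool)) ->
  (forall p, p < k -> f p < m) -> arr s aSet =1 f ->
  wp Check (fun s' t q => [/\ reg s' rHits = tot (hit h k f),
    t <= n * (8 * k + 7) + 3 & q = 0]) s.
Proof.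
move=> cs sK sH fm sS; have [sM sN sO sZ] := cs.
rewrite /Check; wp_run.
pose I i s' t := reg s' rHits = count (hit h k f) (iota 0 i) /\ t <= i * (8 * k + 7).
set s0 := set_reg s 17 0.
apply: (@wp_for inp hid I) => //.
- move=> i s1 t [s1H tl] fr s1I; rewrite /= sN => iltn.
  have [s1M s1N s1O s1Z] := frame_ctx (s := s0) fr isT cs.
  have s1K : reg s1 rK = k by rewrite (freg fr).
  wp_run.
  pose I' p s' t := reg s' rFlag = hit h p f i /\ t <= 8 * p.
  set s2 := set_reg s1 16 _.
  apply: (@wp_for inp hid I') => //.
  + move=> p s3 t3 [s3F t3l] fr3 s3P; rewrite /= s1K => pk.
    have s3I : reg s3 rI = i by rewrite (freg fr3).
    have s3S : arr s3 aSet p = f p by rewrite (farr fr3) //= (farr fr) //= sS.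
    have s3H : arr s3 aMaj (f p) = h (f p).
      by rewrite (farr fr3) //= (farr fr) //= sH ?fm.
    wp_run; apply: wp_neq; rewrite /= s3P s3I s3S s3H.
      move=> ne t0 t0l; wp_run; split=> //; split=> /=; last by lia.
      by rewrite hitS; case: eqP ne => [-> //|]; rewrite andbF.
    move=> e; split=> //; split=> /=; last by lia.
    rewrite s3F hitS; move: e; case: (inp _ _); case: (h _) => //=; by rewrite andbT.
  move=> s3 t3 fr3 [s3F t3l]; rewrite /= s1K in s3F t3l.
  have s3Z : reg s3 rZero = 0 by rewrite (freg fr3).
  have s3H : reg s3 rHits = count (hit h k f) (iota 0 i) by rewrite (freg fr3).
  have eC : count (hit h k f) (iota 0 i.+1) = count (hit h k f) (iota 0 i) + hit h k f i.
    by rewrite -addn1 iotaD count_cat /= addn0.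
  by apply: wp_if; rewrite s3Z s3F => c; wp_run; split=> //; rewrite /I eC; split=> /=;
    try lia; rewrite s3H; move: c; case: (hit h k f i); lia.
move=> s' t fr; rewrite /= sN => -[s'H tl]; split=> //; lia.
Qed.

Lemma wp_NextSet s k f : reg s rK = k -> comb k m f -> arr s aSet =1 f ->
  wp NextSet (fun s' t q => [/\ t <= 9 * k + 12, q = 0 &
    [/\ reg s' rLim = 0, comb k m (arr s' aSet) &
        rank k (arr s' aSet) = (rank k f).+1] \/
    (reg s' rLim = k /\ (rank k f).+1 = 'C(m, k))]) s.
Proof.
move=> sK cf sS; rewrite /NextSet; wp_run.
pose run p := forall q, q < p -> f q.+1 = (f q).+1.
(* Left: the entries up to [p] are consecutive, and those below [p] are already reset. Right: entry
   [p] had room and was raised, and [rLim = 0] stops the loop. *)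
pose I s' t q := q = 0 /\ exists p,
  [/\ [/\ reg s' rP = p, reg s' rLim = k & p <= k], run p,
      forall l, arr s' aSet l = if l < p then l else f l & t <= 9 * p] \/
  [/\ [/\ reg s' rLim = 0, p < k & (f p).+1 < f p.+1], run p,
      forall l, arr s' aSet l = if l < p then l else if l == p then (f l).+1 else f l
      & t <= 9 * p + 9].
have [fk incf] := cf.
set s0 := set_reg _ _ _.
have W := @wp_while inp hid (9 * k + 9) I rP rLim.
apply: wp_mono (W _ s0 _ _ _) _.
- by move=> s' t q [_ [p [[[_ _ pk] _ _ tl]|[[_ pk _] _ _ tl]]]]; lia.
- by split=> //; exists 0; left.
- move=> s1 t q [-> [p [[[s1P s1L pk] runp s1S tl]|[[s1L _ _] _ _ _]]]] fr;
    rewrite s1L // s1P => ltk.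
  have s1p : arr s1 4 p = f p by rewrite s1S ltnn.
  have s1p1 : arr s1 4 p.+1 = f p.+1 by rewrite s1S ltnNge leqnSn.
  wp_run; apply: wp_if; rewrite /= s1P s1p s1p1 => c; wp_run; split=> //;
    [exists p; right|exists p.+1; left].
    split=> //=; last by lia.
    move=> l; rewrite s1P s1S; case: (ltngtP l p) => [||->]; rewrite ?s1p //; lia.
  split=> //=; last by lia.
  + by rewrite s1P.
  + move=> l; rewrite ltnS leq_eqVlt => /predU1P[->|/runp //].
    by have := incf p ltk; lia.
  + move=> l; rewrite s1P s1S; rewrite (ltnS l p) (leq_eqVlt l p).
    by case: (eqVneq l p) => [->|].
move=> s' t q fr [[q0 [p []]]].
- move=> [[s'P s'L pk] runp s'S tl]; rewrite s'P s'L => kp t0.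
  (* The scan ran into the sentinel: the entries are consecutive up to [f k = m], so the rank is the
     largest one. *)
  have ep : p = k by lia.
  split; [lia|lia|right]; split=> //.
  by rewrite -ep (rank_run runp) ep fk.
- move=> [[s'L pk lt] runp s'S tl] _ t0.
  have := @rank_next k m f (arr s' 4) p cf pk runp lt.
  case=> [l lp|||cS rS]; [by rewrite s'S lp | by rewrite s'S ltnn eqxx| |].
    by move=> l pl; rewrite s'S ltnNge (ltnW pl) /= gtn_eqF.
  split; [lia|lia|left]; split=> //.
Qed.

(** Price of trying one k-subset: the check, the successor step and, if the size is exhausted, the
    first subset of the next size. For n, k >= 1 these sum to at most 59 n k. *)
Definition cost k := 60 * n * k.
Definition work a b := \sum_(a <= k < b) 'C(m, k) * cost k.

Lemma workS a b : a <= b -> work a b.+1 = work a b + 'C(m, b) * cost b.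
Proof. by move=> ab; rewrite /work big_nat_recr. Qed.

Lemma leq_work a a' b b' : a' <= a -> b <= b' -> work a b <= work a' b'.
Proof.
move=> aa bb; rewrite /work.
case: (leqP a b) => ab; last by rewrite [leqLHS]big_geq // ltnW.
rewrite (big_cat_nat aa) ?(leq_trans ab) //= (big_cat_nat ab bb) /=; lia.
Qed.

Lemma wp_Search s h k0 d : ctx s -> 0 < n -> reg s rK = k0 -> 0 < k0 <= d -> d <= m ->
  (forall j, j < m -> arr s aMaj j = (h j : bool)) ->
  (exists2 g, comb d m g & tot (hit h d g) <= 1) ->
  wp Search (fun s' t q => exists k,
    [/\ [/\ reg s' rK = k, k0 <= k & k <= d], comb k m (arr s' aSet),
        tot (hit h k (arr s' aSet)) <= 1, t <= work k0 d.+1 + 3 * k0 + 5 & q = 0]) s.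
Proof.
move=> cs n0 sK /andP[k00 k0d] dm sH [g0 cg0 g0h]; rewrite /Search; wp_run.
have [sM sN sO sZ] := cs.
apply: wp_mono (wp_FirstSet sK sM) _ => s1 t1 q1 fr1 [s1S s1Sk t1l ->].
wp_run; set s2 := set_reg _ _ _.
have cs2 : ctx s2 by apply: frame_ctx fr1 isT cs.
have s2H j : j < m -> arr s2 aMaj j = h j by move=> jm; rewrite (farr fr1) ?sH.
have s2K : reg s2 rK = k0 by rewrite /= (freg fr1).
have c0 : comb k0 m (arr s2 aSet) by apply: comb_id => //; apply: leq_trans dm.
(* The time is charged to the exhausted sizes and to the subsets of smaller rank of the current
   size, all refuted; once a set is found, it is charged as well. *)
pose I s' t q := q = 0 /\ exists k,
  [/\ [/\ reg s' rK = k, k0 <= k & k <= d], comb k m (arr s' aSet) &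
    [/\ reg s' rFound = 0,
        forall g, comb k m g -> rank k g < rank k (arr s' aSet) -> 1 < tot (hit h k g) &
        t <= work k0 k + rank k (arr s' aSet) * cost k] \/
    [/\ reg s' rFound = 1, tot (hit h k (arr s' aSet)) <= 1 &
        t <= work k0 k + (rank k (arr s' aSet)).+1 * cost k]].
have It s' t q : I s' t q -> t <= work k0 d.+1.
  move=> [_ [k [[_ k0k kd] ck tl]]].
  apply: (@leq_trans (work k0 k.+1)); last by apply: leq_work.
  rewrite workS //.
  have := rank_lt ck => rl.
  case: tl => [] [_ _ tl]; apply: leq_trans tl _;
    by rewrite leq_add2l leq_mul2r ?rl ?(ltnW rl) orbT.
apply: wp_mono (wp_while It _ _) _.
- split=> //; exists k0; split=> //; left; split=> //.
  by move=> g _; rewrite (@rank_id _ (arr s2 aSet)).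
- move=> s3 t q [-> [k [[s3K k0k kd] ck inv]]] fr lt.
  have cs3 := frame_ctx fr isT cs2; have [s3M s3N s3O s3Z] := cs3.
  case: inv => [[s3F vis tl]|[s3F _ _]]; last by move: lt; rewrite s3F s3O.
  have s3H j : j < m -> arr s3 aMaj j = h j by move=> jm; rewrite (farr fr) ?s2H.
  wp_run; apply: wp_mono (wp_Check cs3 s3K s3H (fun p => comb_lt ck) (frefl _)) _.
  move=> s4 t4 q4 fr4 [s4h t4l ->].
  have cs4 := frame_ctx fr4 isT cs3; have [s4M s4N s4O s4Z] := cs4.
  have s4K : reg s4 rK = k by rewrite (freg fr4).
  have s4S : arr s4 aSet =1 arr s3 aSet by apply: (farr fr4).
  have n1 : n = n.-1.+1 by lia.
  have k1 : k = k.-1.+1 by lia.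
  have costk : n * (8 * k + 7) + 12 * k + 32 <= cost k by rewrite /cost; nia.
  apply: wp_if; rewrite s4O s4h => c; last first.
    wp_run; split=> //; exists k; split=> //=.
      by split=> [|p pk]; rewrite !s4S; case: ck => // _; apply.
    have eh : tot (hit h k (arr s4 4)) = tot (hit h k (arr s3 4)).
      by apply: eq_count_below => i _; apply: eq_hit => p _; rewrite s4S.
    right; split=> //; first by rewrite eh.
    rewrite (eq_rank (g := arr s3 4)) ?mulSn; [lia|by move=> p _; rewrite s4S].
  wp_run; apply: wp_mono (wp_NextSet s4K ck s4S) _ => s5 t5 q5 fr5 [t5l -> st5].
  have cs5 := frame_ctx fr5 isT cs4; have [s5M s5N s5O s5Z] := cs5.
  have s5K : reg s5 rK = k by rewrite (freg fr5).
  have s5F : reg s5 rFound = 0 by rewrite (freg fr5) ?(freg fr4).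
  have vis' g : comb k m g -> rank k g < (rank k (arr s3 4)).+1 -> 1 < tot (hit h k g).
    move=> cg; rewrite ltnS leq_eqVlt => /predU1P[e|]; last exact: vis.
    rewrite (eq_count_below (Q := hit h k (arr s3 4))) // => i _; apply: eq_hit.
    exact: rank_inj cg ck e.
  apply: wp_if; rewrite s5Z => c5; last first.
    case: st5 => [[s5L c5' r5]|[s5L _]]; last by lia.
    wp_run; split=> //; exists k; split=> //; left; rewrite /= r5; split=> //.
    by rewrite mulSn; lia.
  case: st5 => [[s5L _ _]|[s5L r5]]; first by lia.
  (* Size [d] cannot be exhausted: every rank would be refuted, that of [g0] included. *)
  have kd' : k < d.
    rewrite ltn_neqAle kd andbT; apply/eqP => ekd; rewrite ekd in vis' r5.
    by have := vis' _ cg0; rewrite r5 => /(_ (rank_lt cg0)); lia.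
  wp_run; set s6 := set_reg _ _ _.
  have s6K : reg s6 rK = k.+1 by rewrite /= s5K.
  apply: wp_mono (wp_FirstSet s6K s5M) _ => s7 t7 q7 fr7 [s7S s7Sk t7l ->].
  split=> //; exists k.+1; split=> //.
  + by split=> //; [rewrite (freg fr7) | lia].
  + by apply: comb_id => //; lia.
  left; rewrite rank_id //; split=> //.
  + by rewrite (freg fr7).
  + by rewrite workS // -r5 mulSn; lia.
move=> s' t q fr [[q0 [k [[s'K k0k kd] ck inv]]] le t0]; exists k.
have [_ _ s2O _] := cs2.
case: inv => [[s'F _ _]|[s'F s'h tl]].
  by move: le; rewrite s'F (freg fr) // s2O.
have : t.-1 <= work k0 d.+1.
  apply: (It s' _ 0); split=> //; exists k; split=> //; right; split=> //.
by split=> //; lia.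
Qed.

(** * The queries of one phase *)

Definition dis (al h : pred nat) j := tot (fun i => al i && (inp i j != h j)).

(** [rJq] is specified only if [rBest] is positive: where no candidate disagrees, it is not
    assigned. *)
Lemma wp_Choose s al h k f : ctx s -> tab al s -> reg s rK = k ->
  arr s aSet =1 f -> (forall p, p < k -> f p < m) ->
  (forall j, j < m -> arr s aMaj j = (h j : bool)) ->
  wp Choose (fun s' t q => [/\ forall p, p < k -> dis al h (f p) <= reg s' rBest,
    0 < reg s' rBest ->
      exists2 p, p < k & reg s' rJq = f p /\ reg s' rBest = dis al h (f p),
    t <= 9 * k + 3 & q = 0]) s.
Proof.
move=> cs ts sK sS fm sH; rewrite /Choose; wp_run; set s0 := set_reg _ _ _.
pose I l s' t := [/\ forall p, p < l -> dis al h (f p) <= reg s' rBest,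
    0 < reg s' rBest ->
      exists2 p, p < k & reg s' rJq = f p /\ reg s' rBest = dis al h (f p) &
    t <= 9 * l].
apply: (@wp_for inp hid I) => //.
- move=> l s1 t [s1b s1ex tl] fr s1P; rewrite [reg s0 _]sK => lk.
  have cs1 : ctx s1 by apply: (frame_ctx fr isT cs).
  have [_ _ _ s1Z] := cs1.
  have s1S : arr s1 aSet l = f l by rewrite (farr fr) //= sS.
  have s1H : arr s1 aMaj (f l) = h (f l) by rewrite (farr fr) //= sH ?fm.
  have ts1 : tab al s1 by apply: (frame_tab fr isT isT ts).
  have [_ _ /(_ _ (fm l lk))[eO eZ]] := ts1.
  have fin s2 t2 : t2 <= 4 -> reg s2 rBest = reg s1 rBest -> reg s2 rJq = reg s1 rJq ->
      reg s2 rJ = f l -> reg s2 rY = dis al h (f l) ->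
    wp (IfLt rBest rY (Copy rBest rY ;; Copy rJq rJ) Skip)
     (fun s' t' q => I l.+1 (set_reg s' rP l.+1) (t + (t2 + t') + 2) /\ q = 0) s2.
    move=> t2l eB eJq eJ eY; apply: wp_if; rewrite eB eY => c; wp_run; split=> //;
      split=> /=; try lia.
    - move=> p; rewrite eY ltnS leq_eqVlt => /predU1P[->//|/s1b]; lia.
    - by move=> _; exists l; rewrite ?eY ?eJ.
    - move=> p; rewrite eB ltnS leq_eqVlt => /predU1P[->//|]; exact: s1b.
    - by rewrite eB eJq.
  wp_run; apply: wp_if; rewrite /= s1Z s1P s1S s1H => c; wp_run;
    do !(apply: wp_mono (fin _ 4 isT _ _ _ _) _) => //=; rewrite ?s1P ?s1S //.
  + rewrite eZ /dis; apply: eq_count_below => i _.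
    by move: c; case: (h _) => // _; rewrite eqb_id.
  + rewrite eO /dis; apply: eq_count_below => i _.
    by move: c; case: (h _) => // _; case: (inp _ _).
move=> s' t fr; rewrite [reg s0 _]sK => -[s'b s'ex tl]; split=> //; lia.
Qed.

(** If no candidate disagreed with [h] on the set, every candidate would be a hit, but there is at
    most one hit. *)
Lemma dis_gt0 al h k f : 1 < tot al -> tot (hit h k f) <= 1 ->
  exists2 p, p < k & 0 < dis al h (f p).
Proof.
move=> al1 h1.
case: (altP (@hasP _ (fun p => 0 < dis al h (f p)) (iota 0 k))) => [[p]|/hasPn none].
  by rewrite mem_iota => pk ?; exists p.
suff: tot al <= tot (hit h k f) by lia.
apply: count_below_le => i ilt ali; apply/allP => p /none; rewrite -eqn0Ngt => /eqP d0.
apply/negPn/negP => ne.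
by have := @count_below_gt0 n (fun i => al i && (inp i (f p) != h (f p))) i ilt;
  rewrite -/(dis al h (f p)) d0 ali ne => /(_ isT).
Qed.

Lemma wp_Ask s al h k f : ctx s -> tab al s -> reg s rK = k ->
  arr s aSet =1 f -> (forall p, p < k -> f p < m) ->
  (forall j, j < m -> arr s aMaj j = (h j : bool)) ->
  1 < tot al -> tot (hit h k f) <= 1 ->
  wp Ask (fun s' t q => q = 1 /\ exists2 p, p < k & let j := f p in
    let al' := fun i => al i && (inp i j == hid j) in
    [/\ forall p', p' < k -> dis al h (f p') <= dis al h j, 0 < dis al h j,
        tab al' s', reg s' rGo = (if hid j == h j then tot al' else 0) &
        t + (7 * m + 10) * tot al' <= 9 * k + 12 * n + 11 + (7 * m + 10) * tot al]) s.
Proof.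
move=> cs ts sK sS fm sH al1 h1; rewrite /Ask; wp_run.
apply: wp_mono (wp_Choose cs ts sK sS fm sH) _ => s1 t1 q1 fr1 [s1b s1ex t1l ->].
have [p0 p0k d0] := dis_gt0 al1 h1.
have [|p pk [s1J s1B]] := s1ex; first by apply: leq_trans (s1b _ p0k).
set j := f p in s1J s1B.
have cs1 := frame_ctx fr1 isT cs; have ts1 := frame_tab fr1 isT isT ts.
wp_run; set s2 := set_reg _ _ _.
have s2b : reg s2 rBit = hid j by rewrite /= s1J.
have cs2 : ctx s2 by [].
apply: wp_mono (wp_Kill cs2 ts1 s1J s2b) _ => s3 t3 q3 fr3 [ts3 t3l ->].
have cs3 := frame_ctx fr3 isT cs2.
have s3b : reg s3 rBit = hid j by rewrite (freg fr3).
have s3J : reg s3 rJq = j by rewrite (freg fr3).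
have s3H : arr s3 aMaj j = h j.
  by rewrite (farr fr3) //= (farr fr1) // sH // fm.
have [_ s3C _] := ts3.
wp_run; apply: wp_neq; rewrite /= s3J s3H s3b.
  move=> ne t0 t0l; wp_run; split=> //; exists p => //; split=> //=.
  - by move=> p' /s1b; rewrite s1B.
  - by rewrite -s1B; apply: leq_trans (s1b _ p0k).
  - by case: eqP ne => // ->.
  - by rewrite -/j; lia.
move=> e; split=> //; exists p => //; split=> //=.
- by move=> p' /s1b; rewrite s1B.
- by rewrite -s1B; apply: leq_trans (s1b _ p0k).
- by rewrite -/j s3C; move: e; case: (h j); case: (hid j).
- by rewrite -/j; lia.
Qed.

Variable ia : nat.
Hypothesis ia_n : ia < n.
Hypothesis ia_hid : forall j, inp ia j = hid j.

Lemma dis_maj al j : 2 * dis al (maj al) j <= tot al.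
Proof.
rewrite [leqRHS](count_below_split n al (fun i => inp i j)).
set a := tot (fun i => al i && inp i j); set b := tot (fun i => al i && ~~ inp i j).
have e : dis al (maj al) j = if maj al j then b else a.
  by rewrite /dis; case: (maj al j); apply: eq_count_below => i _; case: (inp i j).
by rewrite e /maj -/a -/b; case: ltnP; lia.
Qed.

(* After q agreeing answers, q M + (number of candidates) is at most the initial
   number, where M bounds the disagreements at the coordinates of the set, and at
   q of these coordinates there is no disagreement left. *)
Lemma wp_Rounds s al0 h k f : ctx s -> tab al0 s -> al0 ia -> reg s rK = k ->
  arr s aSet =1 f -> (forall p, p < k -> f p < m) ->
  (forall j, j < m -> arr s aMaj j = (h j : bool)) ->
  (forall j, 2 * dis al0 h j <= tot al0) ->
  reg s rGo = tot al0 -> 1 < tot al0 -> tot (hit h k f) <= 1 ->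
  wp (WhileLt rOne rGo Ask) (fun s' t q =>
    [/\ 0 < q <= k, t <= q * (9 * k + 12 * n + 12) + (7 * m + 10) * tot al0 + 1 &
    exists al, [/\ tab al s', al ia & tot al * maxn 2 q <= tot al0]]) s.
Proof.
move=> cs ts al0a sK sS fm sH h2 sG al1 h1.
set c1 := 7 * m + 10; set c2 := 9 * k + 12 * n + 12; set N := tot al0.
pose I s' t q := exists al, [/\ tab al s', al ia,
  forall i, al i -> al0 i, t + c1 * tot al <= q * c2 + c1 * N &
  [/\ reg s' rGo = tot al, q = 0 -> tot al = N,
      q <= count_below k (fun p => dis al h (f p) == 0) &
      exists M, [/\ forall p, p < k -> dis al h (f p) <= M, q * M + tot al <= N &
                    0 < q -> 0 < M]] \/
  [/\ reg s' rGo = 0, 0 < q <= k & tot al * maxn 2 q <= N]].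
have Iq s' t q : I s' t q -> q <= k.
  move=> [al [_ _ _ _ [[_ _ qz _]|[_ /andP[_ //]]]]].
  by apply: leq_trans qz _; apply: count_below_max.
have It s' t q : I s' t q -> t <= k * c2 + c1 * N.
  move=> Is; have qk := Iq _ _ _ Is; case: Is => al [_ _ _ tl _].
  apply: leq_trans (leq_addr _ _) (leq_trans tl _).
  by rewrite leq_add2r leq_mul2r qk orbT.
apply: wp_mono (wp_while It _ _) _.
- exists al0; split=> //; left; split=> //.
  by exists N; split=> // p pk; apply: count_below_le => i _ /andP[].
- move=> s1 t q [al [ts1 ala sub tl [[s1G q0 qz [M [dM qM M0]]]|[s1G _ _]]]] fr lt;
    last by move: lt; rewrite s1G ltn0.
  have cs1 := frame_ctx fr isT cs; have [s1M s1N s1O s1Z] := cs1.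
  have s1K : reg s1 rK = k by rewrite (freg fr).
  have s1S : arr s1 aSet =1 f by move=> l; rewrite (farr fr).
  have s1H j : j < m -> arr s1 aMaj j = h j by move=> jm; rewrite (farr fr) ?sH.
  have al1' : 1 < tot al by move: lt; rewrite s1G s1O.
  apply: wp_mono (wp_Ask cs1 ts1 s1K s1S fm s1H al1' h1) _.
  move=> s2 t2 _ fr2 [-> [p pk [dp d0 ts2 s2G t2l]]].
  set j := f p in dp d0 ts2 s2G t2l *.
  set al' := (fun i => _) in ts2 s2G t2l.
  have sub' i : al' i -> al i by case/andP.
  have dis_le (a : pred nat) l : (forall i, a i -> al i) -> dis a h l <= dis al h l.
    by move=> aal; apply: count_below_le => i _ /andP[/aal -> ->].
  (* The coordinate just asked still had disagreements, so it was not among the exhausted ones. This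
     yields one more exhausted coordinate after an agreeing answer, and [q < k] after a disagreeing
     one. *)
  have zlt (a b : pred nat) : (forall p', p' < k -> a p' -> b p') -> b p -> ~~ a p ->
      count_below k a < count_below k b.
    move=> ab bp ap; rewrite (count_below_rem pk bp) ltnS.
    apply: count_below_le => p' p'k ap'.
    by rewrite ab //=; apply: contra ap => /eqP <-.
  have eqD : tot al = tot al' + tot (fun i => al i && (inp i j != hid j)).
    exact: count_below_split.
  have qD : q * dis al h j <= q * M by rewrite leq_mul2l dM ?orbT.
  exists al'; split=> //.
  - by rewrite /al' ala ia_hid eqxx.
  - by move=> i /sub' /sub.
  - by rewrite mulnDl mul1n; lia.
  case: (eqVneq (hid j) (h j)) s2G => [e|ne] s2G; [left|right].
    have eD : tot al = tot al' + dis al h j by rewrite eqD e.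
    split=> //; first by lia.
      rewrite addn1; apply: leq_ltn_trans qz _; apply: zlt; last by rewrite -lt0n.
        by move=> p' _ /eqP d; rewrite -leqn0 -d; apply: dis_le.
      rewrite -leqn0 -(count_below0 n) /dis; apply: count_below_le => i _.
      by rewrite /al' -/j -e; case: (al i); case: (_ == _).
    exists (dis al h j); split=> //.
      by move=> p' p'k; apply: leq_trans (dis_le _ _ sub') (dp _ p'k).
    by rewrite mulnDl mul1n; lia.
  have eD : tot al' = dis al h j.
    apply: eq_count_below => i _; rewrite /al' /=.
    by case: (inp i j) (hid j) (h j) ne => -[] [].
  have q1k : q + 1 <= k.
    rewrite addn1; apply: leq_ltn_trans qz _.
    apply: (@leq_trans (count_below k predT)); last exact: count_below_max.
    by apply: zlt => //; rewrite -lt0n.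
  split=> //; first by rewrite addn1 in q1k *.
  (* The candidates left are those that disagreed at [j]. The factor 2 comes from the majority at
     the start of the phase, the factor [q + 1] from [q * M + tot al <= N], as their number is at
     most [M] and at most [tot al]. *)
  rewrite maxnMr geq_max eD; apply/andP; split.
    have := h2 j; have : dis al h j <= dis al0 h j.
      by apply: count_below_le => i _ /andP[/sub -> ->].
    by lia.
  have : dis al h j <= tot al by apply: count_below_le => i _ /andP[].
  by rewrite mulnDr muln1 (mulnC _ q); lia.
move=> s' t q fr [Is le t0]; have qk := Iq _ _ _ Is.
case: Is => al [ts' ala sub tl st].
have tot1 : 0 < tot al by apply: count_below_gt0 ia_n ala.
have [_ _ s1O _] := frame_ctx fr isT cs; rewrite s1O in le.
case: st => [[s'G q0 _ [M [_ qM M0]]]|[_ q0 qN]].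
  (* All answers agreed, so one candidate is left. Some query was asked, as the phase began with
     several, and [M >= 1] then gives [q < N]. *)
  have q1 : 0 < q by rewrite lt0n; apply/eqP => /q0; lia.
  split; [by rewrite q1|lia|exists al; split=> //].
  have {}M0 := M0 q1; have : q * 1 <= q * M by rewrite leq_mul2l M0 orbT.
  by have -> : tot al = 1 by [lia]; rewrite mul1n; lia.
by split=> //; [lia | exists al].
Qed.

(** * Single phases and the whole run *)

Definition size_work a b := \sum_(a <= k < b) 'C(m, k) * k.

Lemma work_size a b : work a b = 60 * n * size_work a b.
Proof.
rewrite /work /size_work big_distrr; apply: eq_bigr => k _ /=.
by rewrite /cost mulnCA.
Qed.

Lemma leq_size_work a k b : a <= k -> k < b -> 'C(m, k) * k <= size_work a b.
Proof.
move=> ak kb; rewrite /size_work (big_cat_nat ak (ltnW kb)) /= (big_ltn kb); lia.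
Qed.

(** Absorption: k C(m, k) = m C(m - 1, k - 1). It fits the O(m n) upkeep of the tallies into the
    time bound. *)
Lemma leq_bin_mul k : 0 < k <= m -> m <= 'C(m, k) * k.
Proof.
case: k m => [|k] [|m'] //= km; rewrite mulnC -mul_bin_diag leq_pmulr //.
by rewrite bin_gt0.
Qed.

Variable d : nat.
Hypothesis d_m : d <= m.
Hypothesis spec : forall h : nat -> bool, exists2 g, comb d m g & tot (hit h d g) <= 1.

(** Each phase is charged a search through all sizes from [k0] to [d]; the number of phases will
    supply the factor log n. *)
Lemma wp_Phase s al0 k0 : ctx s -> tab al0 s -> al0 ia -> reg s rK = k0 ->
  0 < k0 <= d -> 1 < tot al0 ->
  wp Phase (fun s' t q =>
    [/\ 0 < q <= d, t <= 200 * n * size_work k0 d.+1 &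
    exists al, [/\ tab al s', al ia, tot al * maxn 2 q <= tot al0,
      ctx s' & k0 <= reg s' rK <= d]]) s.
Proof.
move=> cs ts al0a sK /andP[k00 k0d] al1; rewrite /Phase; wp_run.
apply: wp_mono (wp_Majority cs ts) _ => s1 t1 q1 fr1 [s1H t1l ->].
have cs1 := frame_ctx fr1 isT cs; have ts1 := frame_tab fr1 isT isT ts.
have s1K : reg s1 rK = k0 by rewrite (freg fr1).
have n0 : 0 < n by lia.
have k0d' : 0 < k0 <= d by rewrite k00.
wp_run.
apply: wp_mono (wp_Search cs1 n0 s1K k0d' d_m s1H (spec (maj al0))) _.
move=> s2 t2 q2 fr2 [k [[s2K k0k kd] ck h1 t2l ->]].
have cs2 := frame_ctx fr2 isT cs1; have ts2 := frame_tab fr2 isT isT ts1.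
have s2H j : j < m -> arr s2 aMaj j = maj al0 j by move=> jm; rewrite (farr fr2) ?s1H.
wp_run; set s3 := set_reg _ _ _; have [_ s2C _] := ts2.
have cs3 : ctx s3 by [].
have ts3 : tab al0 s3 by [].
have s3K : reg s3 rK = k by [].
have s3S : arr s3 aSet =1 arr s2 aSet by [].
apply: wp_mono (wp_Rounds cs3 ts3 al0a s3K s3S (fun p => comb_lt ck) s2H
   (dis_maj al0) s2C al1 h1) _.
move=> s4 t4 q4 fr4 [/andP[q40 q4k] t4l [al [ts4 ala al_le]]].
have cs4 := frame_ctx fr4 isT cs3.
have tot_n := count_below_max n al0.
set S := size_work k0 d.+1.
have S1 : m <= S.
  apply: leq_trans (leq_size_work (leqnn k0) _); last by rewrite ltnS.
  by apply: leq_bin_mul; rewrite k00 (leq_trans k0d).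
have S2 : k <= S.
  apply: leq_trans (leq_size_work k0k _); last by rewrite ltnS.
  by rewrite leq_pmull // bin_gt0 (leq_trans kd).
have q4n : q4 <= n.
  apply: leq_trans tot_n; apply: leq_trans al_le.
  apply: (@leq_trans (maxn 2 q4)); first by rewrite leq_maxr.
  by rewrite leq_pmull // (count_below_gt0 ia_n ala).
split; last first.
- exists al; split=> //.
  by rewrite (freg fr4) // s3K k0k.
- rewrite work_size -/S in t2l.
  (* Every term of the running time is at most a multiple of [n * S], and the coefficients sum to
     less than 200. *)
  have e1 : q4 * k <= n * S by apply: leq_mul.
  have e2 : q4 * n <= n * S by rewrite mulnC leq_mul2l (leq_trans q4k S2) orbT.
  have e3 : m * tot al0 <= n * S by rewrite mulnC leq_mul.
  have e4 : tot al0 <= n * S by apply: leq_trans tot_n _; rewrite leq_pmulr //; lia.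
  have e5 : m <= n * S by rewrite (leq_trans S1) // leq_pmull.
  have e6 : k0 <= n * S by rewrite (leq_trans k0k) // (leq_trans S2) // leq_pmull.
  have e7 : q4 <= n * S by rewrite (leq_trans q4k) // (leq_trans S2) // leq_pmull.
  have e8 : 1 <= n * S by lia.
  lia.
- by rewrite ?addn0 ?add0n q40 (leq_trans q4k).
Qed.

Lemma wp_Output s al : ctx s -> tab al s -> al ia -> tot al = 1 ->
  wp Output (fun s' t q => [/\ reg s' 0 = ia, t <= 5 * n + 2 & q = 0]) s.
Proof.
move=> cs ts ala al1; have [_ sN _ _] := cs.
pose I i s' t := (ia < i -> reg s' 0 = ia) /\ t <= 5 * i.
apply: (@wp_for inp hid I) => //.
- move=> i s1 t [s1a tl] fr s1I; rewrite sN => iltn.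
  have s1Z : reg s1 rZero = 0 by rewrite (freg fr) //; case: cs.
  have s1A : arr s1 aAlive i = al i by rewrite (farr fr) //; case: ts => ->.
  wp_run; apply: wp_if; rewrite /= s1I s1Z s1A => c; wp_run; split=> //; split=> /=;
    try lia.
    by move=> _; rewrite s1I; apply: (count_below_eq1 al1) => //; case: (al i) c.
  rewrite ltnS leq_eqVlt => /predU1P[e|//].
  by move: c; rewrite -e ala.
by move=> s' t fr; rewrite sN => -[s'a tl]; split=> //; [apply: s'a | lia].
Qed.

Lemma size_work_gt0 a b : 0 < a < b -> a <= m -> m <= size_work a b.
Proof.
move=> /andP[a0 ab] am; apply: leq_trans (leq_size_work (leqnn a) ab).
by apply: leq_bin_mul; rewrite a0.
Qed.

Lemma leq_size_workl a a' b : a' <= a -> a <= b -> size_work a b <= size_work a' b.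
Proof. by move=> aa ab; rewrite /size_work (big_cat_nat aa ab) /= leq_addl. Qed.

Lemma exp_size_prod (ks : seq nat) : 2 ^ size ks <= \prod_(k <- ks) maxn 2 k.
Proof.
elim: ks => [|k ks IH]; first by rewrite big_nil.
by rewrite big_cons expnS leq_mul // leq_maxl.
Qed.

(** [ks] lists the numbers of queries of the phases. The bound on the product yields the query bound
    and, by [exp_size_prod], at most log n phases. *)
Lemma wp_Learn e : 1 < n -> 0 < d -> e <= d ->
  wp Learn (fun s' t q => reg s' 0 = ia /\ exists ks : seq nat,
    [/\ q = sumn ks, all (fun k => 0 < k <= d) ks,
        \prod_(k <- ks) maxn 2 k <= n &
        t <= 300 * (size ks * (n * size_work (maxn e 1) d.+1))]) (start m n e).
Proof.
move=> n1 d0 ed; rewrite /Learn; wp_run; set s0 := set_reg _ _ _.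
apply: wp_if; rewrite [reg s0 rN]/= [reg s0 rOne]/= => c; last by lia.
set k0 := maxn e 1; set S := size_work k0 d.+1.
have k00 : 0 < k0 by rewrite leq_maxr.
have k0d : k0 <= d by rewrite geq_max ed.
have mS : m <= S by apply: size_work_gt0; [rewrite k00 ltnS | apply: leq_trans d_m].
(* Both branches of the test take two steps and leave [max(e, 1)] in [rK]. *)
suff main s t0 : t0 <= 2 -> ctx s -> reg s rK = k0 -> tab (fun=> false) s ->
  wp (Init ;; WhileLt rOne rCnt Phase ;; Output) (fun s' t q => reg s' 0 = ia /\
    exists ks : seq nat, [/\ q = sumn ks, all (fun k => 0 < k <= d) ks,
        \prod_(k <- ks) maxn 2 k <= n &
        3 + t0 + t <= 300 * (size ks * (n * S))]) s.
  have ts0 s : reg s rCnt = 0 -> (forall b j, arr s b j = 0) -> tab (fun=> false) s.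
    by move=> sC sA; split=> [i _||j _]; rewrite ?sA ?sC ?count_below0.
  apply: wp_then; apply: wp_if => /= e1; wp_step;
    apply: wp_mono (main _ 2 _ _ _ _) _ => //=; try by [apply: ts0].
  - by rewrite /k0; move: e1 => /=; lia.
  - by rewrite /k0; move: e1 => /=; lia.
move=> t0l cs sK ts; wp_run.
apply: wp_mono (wp_Init cs ts) _ => s1 t1 q1 fr1 [ts1 t1l ->].
have cs1 := frame_ctx fr1 isT cs; have s1K : reg s1 rK = k0 by rewrite (freg fr1).
wp_run.
pose I s' t q := exists al (ks : seq nat),
  [/\ tab al s', al ia, ctx s' & k0 <= reg s' rK <= d] /\
  [/\ q = sumn ks, all (fun k => 0 < k <= d) ks,
      tot al * \prod_(k <- ks) maxn 2 k <= n, ks = [::] -> tot al = n &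
      t <= size ks * (200 * n * S + 1)].
have size_n (al : pred nat) (ks : seq nat) : al ia ->
    tot al * \prod_(k <- ks) maxn 2 k <= n -> size ks <= n.
  move=> ala le; apply/ltnW/(leq_trans (ltn_expl _ (leqnn 2))).
  apply: leq_trans (exp_size_prod _) _.
  by apply: leq_trans le; rewrite leq_pmull // (count_below_gt0 ia_n ala).
(* For termination the crude bound of [n] phases is enough. *)
have It s' t q : I s' t q -> t <= n * (200 * n * S + 1).
  move=> [al [ks [[_ ala _ _] [_ _ le _ tl]]]]; apply: leq_trans tl _.
  by rewrite leq_mul2r (size_n al) ?orbT.
have totT : tot predT = n by rewrite /count_below count_predT size_iota.
apply: wp_mono (wp_while It _ _) _.
- exists predT, [::]; do !split=> //; first by rewrite s1K leqnn.
  by rewrite big_nil muln1 totT.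
- move=> s2 t q [al [ks [[ts2 ala cs2 /andP[kk kd]] [-> ksd le _ tl]]]] fr.
  have [_ _ s2O _] := cs2; have [_ s2C _] := ts2; rewrite s2O s2C => al1.
  have kd' : 0 < reg s2 rK <= d by rewrite kd andbT (leq_trans k00).
  apply: wp_mono (wp_Phase cs2 ts2 ala erefl kd' al1) _.
  move=> s3 t3 q3 fr3 [q3d t3l [al' [ts3 al'a al'le cs3 /andP[kk' kd'']]]].
  exists al', (q3 :: ks); split; first by split=> //; rewrite (leq_trans kk kk').
  split=> //=.
  + by rewrite addnC.
  + by rewrite q3d.
  + by rewrite big_cons mulnA; apply: leq_trans le; rewrite leq_mul2r al'le orbT.
  + have : 200 * n * size_work (reg s2 rK) d.+1 <= 200 * n * S.
      by rewrite leq_mul2l leq_size_workl ?orbT // ltnW.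
    by rewrite mulSn; lia.
move=> s2 t2 q2 fr2 [[al [ks [[ts2 ala cs2 _] [-> ksd le ks0 tl]]]] le1 t20].
have [_ _ s2O _] := cs2; have [_ s2C _] := ts2; rewrite s2O s2C in le1.
have al1 : tot al = 1 by have := count_below_gt0 ia_n ala; lia.
apply: wp_mono (wp_Output cs2 ts2 ala al1) _ => s3 t3 q3 fr3 [s3a t3l ->].
split=> //; exists ks; split=> //.
- by rewrite !addn0.
- by move: le; rewrite al1 mul1n.
(* As n > 1, at least one phase took place, so initialisation and output fit into a bound
   proportional to the number of phases. *)
have ks1 : 0 < size ks by case: (ks) ks0 => // /(_ erefl); lia.
set z := size ks in ks1 tl *.
have S1 : 1 <= S by lia.
have e1 : n * m <= n * S by rewrite leq_mul2l mS orbT.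
have e2 : n <= n * S by rewrite leq_pmulr.
have e3 : n * S <= z * (n * S) by rewrite leq_pmull.
have e4 : z <= z * (n * S) by rewrite leq_pmulr //; lia.
lia.
Qed.

End Correctness.

(** * Specifying sets and decision trees *)

Section Dimension.
Variable m : nat.
Implicit Types (A : {set vec m}) (t : dtree m) (h : vec m).

Lemma OPT_tree A : exists2 t, decides A t & depth t = OPT A.
Proof.
by rewrite /OPT; case: ex_minnP => k /boolp.asboolP[t [tA tk]] _; exists t.
Qed.

(** Each subtree of the root decides the part of [A] that gives its answer, so the number of
    elements at most doubles per level. *)
Lemma decides_card t A : decides A t -> #|A| <= 2 ^ depth t.
Proof.
elim: t A => [|i t0 IH0 t1 IH1] A tA /=.
  by apply/card_le1P => a aA b; rewrite inE; apply/idP/eqP => [bA|->//]; exact: tA.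
have split_b (b : bool) t' :
    (forall a : vec m, a i = b -> asked (Node i t0 t1) a = i :: asked t' a) ->
    decides [set a in A | a i == b] t'.
  move=> at' a b'; rewrite !inE => /andP[aA /eqP ai] /andP[b'A /eqP bi] ab.
  by apply: tA => //; rewrite at' //= bi ai eqxx.
have H1 := IH1 _ (split_b true t1 _); have H0 := IH0 _ (split_b false t0 _).
rewrite -(cardsID [set a : vec m | a i] A).
have -> : A :&: [set a : vec m | a i] = [set a in A | a i == true].
  by apply/setP => a; rewrite !inE eqb_id.
have -> : A :\: [set a : vec m | a i] = [set a in A | a i == false].
  by apply/setP => a; rewrite !inE eqbF_neg andbC.
rewrite expnS mul2n -addnn leq_add //.
  by apply: leq_trans (H1 _) _ => [a /= ->|]; rewrite ?leq_exp2l ?leq_maxr.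
by apply: leq_trans (H0 _) _ => [a /= ->|]; rewrite ?leq_exp2l ?leq_maxl.
Qed.

Lemma leq_card_OPT A : #|A| <= 2 ^ OPT A.
Proof. by have [t tA <-] := OPT_tree A; exact: decides_card. Qed.

Lemma ETDh_specifying A h : exists2 S, specifying A h S & #|S| = ETDh A h.
Proof.
rewrite /ETDh; case: arg_minnP => [|S AS _]; first exact: specifying_setT.
by exists S.
Qed.

Lemma leq_ETDh A h S : specifying A h S -> ETDh A h <= #|S|.
Proof.
rewrite /ETDh; case: arg_minnP => [|S' _ minS' /minS' //].
exact: specifying_setT.
Qed.

Lemma leq_ETDh_ETD A h : ETDh A h <= ETD A.
Proof. exact: leq_bigmax. Qed.

Lemma size_asked t h : size (asked t h) <= depth t.
Proof.
elim: t => //= i t0 IH0 t1 IH1.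
by rewrite ltnS leq_max; case: (h i); rewrite ?IH0 ?IH1 ?orbT.
Qed.

(** An element agreeing with [h] along the path of [h] follows that path; two such elements give the
    same answers, hence are equal. *)
Lemma decides_specifying A t h : decides A t -> specifying A h [set i in asked t h].
Proof.
move=> tA; apply/card_le1P => a; rewrite !inE => /andP[aA ah] b.
have eq_on (c : vec m) : [forall i in [set i in asked t h], c i == h i] ->
    all (fun i => c i == h i) (asked t h).
  by move=> /forall_inP ch; apply/allP => i it; apply: ch; rewrite inE.
have asked_eq : asked t a = asked t h.
  move/eq_on: ah; elim: (t) => //= i t0 IH0 t1 IH1 /andP[/eqP ->] ah.
  by congr cons; case: (h i) ah.
rewrite !inE; apply/andP/eqP => [[bA bh]|->]; last by split.
apply: tA => //; rewrite asked_eq; apply/allP => i it.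
by rewrite (eqP (allP (eq_on _ bh) _ it)) (eqP (allP (eq_on _ ah) _ it)).
Qed.

Lemma ETD_le_OPT A : ETD A <= OPT A.
Proof.
have [t tA <-] := OPT_tree A; apply/bigmax_leqP => h _.
apply: leq_trans (leq_ETDh (decides_specifying h tA)) _.
by rewrite cardsE (leq_trans (card_size _)) ?size_asked.
Qed.

Lemma ETD_le_dim A : ETD A <= m.
Proof.
apply/bigmax_leqP => h _; have [S _ <-] := ETDh_specifying A h.
by rewrite -[leqRHS](card_ord m) max_card.
Qed.

Lemma ETD_gt0 A : 1 < #|A| -> 0 < ETD A.
Proof.
move=> A1; apply: leq_trans (leq_ETDh_ETD A [ffun=> false]).
have [S AS <-] := ETDh_specifying A [ffun=> false].
rewrite card_gt0; apply/eqP => S0; move: AS A1; rewrite S0 /specifying => AS.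
suff -> : A = [set a in A | [forall i in set0, a i == [ffun=> false] i]].
  by rewrite ltnNge AS.
apply/setP => a; rewrite !inE; case: (a \in A) => //=.
by apply/esym/forall_inP => i; rewrite inE.
Qed.

Lemma subset_of_card (T : finType) (S : {set T}) k : #|S| <= k <= #|T| ->
  exists2 U : {set T}, S \subset U & #|U| = k.
Proof.
move=> /andP[Sk kT]; pose u := take (k - #|S|) (enum (~: S)).
have uS : uniq u by rewrite take_uniq ?enum_uniq.
exists (S :|: [set x in u]); first exact: subsetUl.
rewrite cardsU (_ : S :&: _ = set0) ?cards0 ?subn0.
  rewrite cardsE (card_uniqP uS) size_takel ?subnKC // -cardE.
  by rewrite leq_subLR cardsC.
apply/setP => x; rewrite !inE; apply/negP => /andP[xS /mem_take].
by rewrite mem_enum inE xS.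
Qed.

Lemma sorted_enum_ord (T : {set 'I_m}) : sorted ltn (map val (enum T)).
Proof.
rewrite sorted_map /enum_mem sorted_filter //; first by move=> ? ? ?; apply: ltn_trans.
by rewrite -enumT -sorted_map val_enum_ord iota_ltn_sorted.
Qed.

Lemma coord_ord (v : vec m) (i : 'I_m) : Defs.coord v i = v i.
Proof. by rewrite /Defs.coord valK. Qed.

(** The minimum for one [h] may be below ETD(A), but a specifying set stays specifying when
    enlarged, so exactly ETD(A) elements can be had. *)
Lemma comb_specifying A (s : seq (vec m)) (h : nat -> bool) : perm_eq s (enum A) ->
  exists2 g, comb (ETD A) m g & count_below (size s) (hit (rows s) h (ETD A) g) <= 1.
Proof.
move=> sA; pose hv : vec m := [ffun i : 'I_m => h i].
have [S AS S_card] := ETDh_specifying A hv.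
have [|T ST T_card] := @subset_of_card _ S (ETD A).
  by rewrite S_card leq_ETDh_ETD card_ord ETD_le_dim.
pose e := map val (enum T); have e_size : size e = ETD A by rewrite size_map -cardE.
(* The default value [m] of [nth] supplies the sentinel. *)
exists (nth m e).
  split=> [|p pd]; first by rewrite nth_default ?e_size.
  case: (ltnP p.+1 (ETD A)) => p1.
    by apply: (sorted_ltn_nth ltn_trans) => //; rewrite ?inE ?e_size ?sorted_enum_ord.
  rewrite (nth_default _ (n := p.+1)) ?e_size //.
  have pe : p < size e by rewrite e_size.
  by have /mapP[i _ ->] := mem_nth m pe; apply: ltn_ord.
pose Q (v : vec m) :=
  all (fun p => Defs.coord v (nth m e p) == h (nth m e p)) (iota 0 (ETD A)).
have -> : count_below (size s) (hit (rows s) h (ETD A) (nth m e)) = count Q s.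
  by rewrite -[in RHS](mkseq_nth [ffun=> false] s) /mkseq count_map.
rewrite (permP sA) -size_filter; apply: leq_trans AS; rewrite cardE.
apply: uniq_leq_size => [|a]; first by rewrite filter_uniq ?enum_uniq.
rewrite mem_filter !mem_enum !inE => /andP[/allP aQ ->]; apply/forall_inP => i iS.
have ie : val i \in e by rewrite map_f // mem_enum (subsetP ST).
have := aQ (index (val i) e); rewrite nth_index // coord_ord ffunE; apply.
by rewrite mem_iota -e_size index_mem.
Qed.

End Dimension.

(** The additional 4 steps are the run on a single candidate, where no phase takes place. *)
Lemma Learn_finds m (A : {set vec m}) (s : seq (vec m)) (a : vec m) e :
  perm_eq s (enum A) -> a \in A -> e <= ETD A ->
  exists (t : nat) (ks : seq nat),
    [/\ finds Learn s e a t (sumn ks),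
        all (fun k => 0 < k <= ETD A) ks, \prod_(k <- ks) maxn 2 k <= #|A| &
        t <= 300 * (size ks * (#|A| * size_work m (maxn e 1) (ETD A).+1)) + 4].
Proof.
move=> sA aA ed; have As : a \in s by rewrite (perm_mem sA) mem_enum.
have s_size : size s = #|A| by rewrite (perm_size sA) cardE.
have ia_n : index a s < size s by rewrite index_mem.
case: (ltnP 1 #|A|) => A1.
  have ia_hid j : rows s (index a s) j = Defs.coord a j by rewrite /rows nth_index.
  rewrite -s_size in A1 *.
  have d0 : 0 < ETD A by rewrite ETD_gt0 // -s_size.
  have [st [t [q [ex [st0 [ks [qE ksd le tl]]]]]]] :=
    wp_Learn ia_n ia_hid (ETD_le_dim A) (fun h => comb_specifying h sA) A1 d0 ed.
  rewrite qE in ex; exists t, ks; split=> //; first by exists st.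
  exact: leq_trans tl (leq_addr _ _).
suff [st [t [q [ex [st0 q0 tl]]]]] : wp (rows s) (Defs.coord a) Learn
    (fun s' t q => [/\ reg s' 0 = 0, q = 0 & t <= 4]) (start m (size s) e).
  rewrite q0 in ex; exists t, [::]; split=> //.
  - by exists st; split=> //; rewrite st0; move: ia_n; rewrite s_size; lia.
  - by rewrite big_nil -s_size; lia.
rewrite /Learn; wp_run; set s0 := set_reg _ _ _.
by apply: wp_if; rewrite [reg s0 rN]/= [reg s0 rOne]/= s_size => c; [lia|wp_run].
Qed.

(** * Bounds on time and queries *)

Section Bounds.
Local Open Scope ring_scope.
Variable R : realType.

Lemma ln2_ge_half : 2^-1 <= ln 2 :> R.
Proof.
have := @le_ln1Dx R (- 2^-1) ltac:(lra).
by rewrite (_ : 1 + - 2^-1 = 2^-1 :> R) ?lnV ?posrE; lra.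
Qed.

Lemma ln2_gt0 : 0 < ln 2 :> R.
Proof. by have := ln2_ge_half; lra. Qed.

Lemma log2_ge0 n : 0 <= log2 n%:R :> R.
Proof.
case: n => [|n]; first by rewrite /log2 ln0 // mul0r.
by apply: divr_ge0; rewrite ?(ltW ln2_gt0) // ln_ge0 // ler1n.
Qed.

Lemma leq_log2 k n : (2 ^ k <= n)%N -> k%:R <= log2 n%:R :> R.
Proof.
move=> kn; have n0 : (0 < n)%N by apply: leq_trans kn; rewrite expn_gt0.
rewrite ler_pdivlMr ?ln2_gt0 // mulr_natl -lnXn //.
by rewrite ler_ln ?posrE ?exprn_gt0 ?ltr0n // -natrX ler_nat.
Qed.

Lemma log2_leq k n : (0 < n <= 2 ^ k)%N -> log2 n%:R <= k%:R :> R.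
Proof.
move=> /andP[n0 nk]; rewrite ler_pdivrMr ?ln2_gt0 // mulr_natl -lnXn //.
by rewrite ler_ln ?posrE ?exprn_gt0 ?ltr0n // -natrX ler_nat.
Qed.

(* Concavity: ln d <= ln k + (d - k) / k, and 1 <= 2 ln k for k >= 2. *)
Lemma mul_ln_le k d : (2 <= k <= d)%N -> k%:R * ln d%:R <= 2 * d%:R * ln k%:R :> R.
Proof.
move=> /andP[k2 kd].
have k0 : 0 < k%:R :> R by rewrite ltr0n; lia.
have d0 : 0 < d%:R :> R by rewrite ltr0n; lia.
have kdR : k%:R <= d%:R :> R by rewrite ler_nat.
have lnk : 2^-1 <= ln k%:R :> R.
  by apply: le_trans ln2_ge_half _; rewrite ler_ln ?posrE // ler_nat.
have conc : ln d%:R - ln k%:R <= d%:R / k%:R - 1 :> R.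
  rewrite -ln_div ?posrE //.
  have := @le_ln1Dx R (d%:R / k%:R - 1).
  by rewrite (addrC 1) subrK; apply; have := divr_gt0 d0 k0; lra.
have : k%:R * (ln d%:R - ln k%:R) <= d%:R - k%:R :> R.
  apply: le_trans (ler_wpM2l (ltW k0) conc) _.
  by rewrite mulrBr mulr1 mulrC divfK // gt_eqF.
(* k ln k + (d - k) <= k ln k + 2 (d - k) ln k <= 2 d ln k. *)
nra.
Qed.

Lemma queries_bound d (ks : seq nat) : (1 < d)%N ->
  all (fun k => 0 < k <= d)%N ks ->
  (sumn ks)%:R * ln d%:R <= 2 * d%:R * ln (\prod_(k <- ks) maxn 2 k)%:R :> R.
Proof.
move=> d1; elim: ks => [_|k ks IH /= /andP[/andP[k0 kd] /IH le]].
  by rewrite big_nil ln1 mul0r mulr0.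
rewrite big_cons natrD natrM mulrDl lnM ?posrE ?ltr0n ?leq_max //; last first.
  by apply: leq_trans (exp_size_prod _); rewrite expn_gt0.
(* A phase with one query is bounded as if it had two, which [1 < d] allows. *)
rewrite mulrDr lerD // (le_trans _ (@mul_ln_le (maxn 2 k) d _)) ?leq_maxl ?geq_max ?d1 //.
by rewrite ler_wpM2r ?ln_ge0 ?ler1n ?ler_nat ?leq_maxr // ltnW.
Qed.

Lemma query_bound d n (ks : seq nat) : (1 < d)%N ->
  all (fun k => 0 < k <= d)%N ks -> (\prod_(k <- ks) maxn 2 k <= n)%N ->
  (sumn ks)%:R <= 2 * d%:R * log2 n%:R / log2 d%:R :> R.
Proof.
move=> d1 ksd prod_n.
have prod0 : (0 < \prod_(k <- ks) maxn 2 k)%N.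
  by apply: leq_trans (exp_size_prod _); rewrite expn_gt0.
have lnd0 : 0 < ln d%:R :> R by rewrite ln_gt0 // ltr1n.
rewrite ler_pdivlMr; last by rewrite divr_gt0 ?ln2_gt0.
rewrite /log2 !mulrA ler_wpM2r ?invr_ge0 ?(ltW ln2_gt0) //.
apply: le_trans (queries_bound d1 ksd) _; rewrite ler_wpM2l ?mulr_ge0 ?ler0n //.
by rewrite ler_ln ?posrE ?ltr0n ?ler_nat // (leq_trans prod0).
Qed.

(** Both ETD(A) and log n are at most OPT(A), and their product is their minimum times their
    maximum. *)
Lemma query_bound_OPT m (A : {set vec m}) : (0 < #|A|)%N -> (1 < ETD A)%N ->
  2 * (ETD A)%:R * log2 #|A|%:R / log2 (ETD A)%:R <=
    2 * Num.min (ETD A)%:R (log2 #|A|%:R) / log2 (ETD A)%:R * (OPT A)%:R :> R.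
Proof.
move=> A0 d1; set d := ETD A in d1 *.
have lnd0 : 0 < log2 d%:R :> R by rewrite divr_gt0 ?ln2_gt0 // ln_gt0 // ltr1n.
rewrite [leRHS]mulrAC ler_pM2r ?invr_gt0 // -!mulrA ler_pM2l //.
have dO : d%:R <= (OPT A)%:R :> R by rewrite ler_nat ETD_le_OPT.
have LO : log2 #|A|%:R <= (OPT A)%:R :> R by rewrite log2_leq // A0 leq_card_OPT.
by rewrite minEle; case: ifP => _;
  [rewrite ler_wpM2l | rewrite mulrC ler_wpM2l ?log2_ge0].
Qed.

Lemma time_bound (s n S : nat) : (2 ^ s <= n)%N ->
  (300 * (s * (n * S)) + 4)%:R <= 300%:R * (S%:R * (n%:R * log2 n%:R) + 1) :> R.
Proof.
move=> /leq_log2 sn; rewrite natrD !natrM mulrDr lerD //; last by rewrite mulr1 ler_nat.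
rewrite ler_wpM2l ?ler0n // [s%:R * _]mulrC -mulrA mulrCA ler_wpM2l ?ler0n //.
by rewrite ler_wpM2l ?ler0n.
Qed.

End Bounds.

(** * Polynomial bounds when ETD(A) is bounded *)

Lemma bin_le_exp m k : 'C(m, k) <= m.+1 ^ k.
Proof.
elim: m k => [|m IH] [|k]; rewrite ?bin0 ?bin0n //.
rewrite binS; apply: (@leq_trans (m.+1 ^ k.+1 + m.+1 ^ k)); first exact: leq_add.
rewrite expnS -mulSnr expnS leq_mul2l /=.
by case: (k) => // k'; rewrite leq_exp2r // leqnSn.
Qed.

Lemma size_work_poly m a d k : d <= k -> size_work m a d.+1 <= k.+1 * (m.+1 ^ k * k).
Proof.
move=> dk; apply: (@leq_trans (size_work m 0 k.+1)).
  case: (leqP a d.+1) => ad; last by rewrite [leqLHS]big_geq // ltnW.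
  have dk1 : d < k.+1 by [].
  rewrite /size_work (big_cat_nat (leq0n a) (leq_trans ad dk1)) /=.
  by rewrite [X in _ + X](big_cat_nat ad dk1) addnCA leq_addr.
rewrite /size_work big_mkord -[X in X * _](card_ord k.+1) -sum_nat_const.
apply: leq_sum => i _; apply: leq_mul; last by rewrite -ltnS.
by apply: leq_trans (bin_le_exp _ _) _; rewrite leq_pexp2l // -ltnS.
Qed.

(** With at most log n <= OPT(A) phases, this gives the constant-factor approximation even where log
    ETD(A) = 0. *)
Lemma sumn_le d (ks : seq nat) : all (fun k => 0 < k <= d) ks -> sumn ks <= d * size ks.
Proof. by elim: ks => [|k ks IH] //= /andP[/andP[_ kd] /IH]; lia. Qed.
Local Open Scope ring_scope.

(* The same program P is run with ETD(A) as auxiliary number (first part), with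
   0, i.e. on A alone (second part), and with any lower bound of ETD(A), 0 and
   ETD(A) included (third part).  The first part has the exact time bound for
   subsets of size ETD(A) only; on A alone the sizes 0 to ETD(A) all have to
   be tried, whence the sum.  When ETD(A) <= 1 the query bound is a division by
   log 1 = 0; that case is covered by the third part. *)
Theorem theorem2 (R : realType) :
  exists (P : cmd) (C : nat),
    [/\ (forall (m : nat) (A : {set vec m}) (s : seq (vec m)) (a : vec m),
          perm_eq s (enum A) -> a \in A ->
          let d := ETD A in
          let n := #|A| in
          exists t q : nat,
            [/\ finds P s d a t q,
                t%:R <= C%:R *
                  ('C(m, d)%:R * d%:R * (n%:R * log2 n%:R) + 1) :> R &
                (1 < d)%N ->
                q%:R <= 2 * d%:R * log2 n%:R / log2 d%:R :> R /\
                2 * d%:R * log2 n%:R / log2 d%:R <=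
                  2 * Num.min d%:R (log2 n%:R) / log2 d%:R * (OPT A)%:R :> R]),
        (forall (m : nat) (A : {set vec m}) (s : seq (vec m)) (a : vec m),
          perm_eq s (enum A) -> a \in A ->
          let d := ETD A in
          let n := #|A| in
          exists t q : nat,
            [/\ finds P s 0 a t q,
                t%:R <= C%:R *
                  (\sum_(k < d.+1) 'C(m, k)%:R * k%:R * (n%:R * log2 n%:R) + 1)
                  :> R &
                (1 < d)%N ->
                q%:R <= 2 * d%:R * log2 n%:R / log2 d%:R :> R]) &
        (forall k : nat, exists K : nat,
          forall (m : nat) (A : {set vec m}) (s : seq (vec m)) (a : vec m)
            (e : nat),
            perm_eq s (enum A) -> a \in A ->
            (ETD A <= k)%N -> (e <= ETD A)%N ->
            exists t q : nat,
              [/\ finds P s e a t q,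
                  (t <= K * (m + #|A| + 1) ^ K)%N &
                  (q <= K * OPT A)%N])].
Proof.
exists Learn, 300%N.
have card0 m (A : {set vec m}) a : a \in A -> (0 < #|A|)%N.
  by move=> aA; apply/card_gt0P; exists a.
have size_exp (ks : seq nat) n : (\prod_(k <- ks) maxn 2 k <= n -> 2 ^ size ks <= n)%N.
  exact: leq_trans (exp_size_prod _).
split=> [m A s a sA aA d n|m A s a sA aA d n|k].
- have [t [ks [fnd ksd prod_n tl]]] := Learn_finds sA aA (leqnn d).
  exists t, (sumn ks); split=> //; last first.
    by move=> d1; split; [apply: query_bound|apply: query_bound_OPT; rewrite ?(card0 _ _ a)].
  (* Started at [e = d], the search tries size [d] only. For [d = 0] the range of sizes is empty and
     both sides vanish. *)
  have -> : 'C(m, d)%:R * d%:R = (size_work m (maxn d 1) d.+1)%:R :> R.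
    rewrite -natrM /size_work; case: (posnP d) => [->|d0].
      by rewrite big_geq // muln0.
    by rewrite (maxn_idPl d0) big_nat1.
  by apply: le_trans _ (time_bound _ _ (size_exp _ _ prod_n)); rewrite ler_nat.
- have [t [ks [fnd ksd prod_n tl]]] := Learn_finds sA aA (leq0n d).
  exists t, (sumn ks); split=> //; last by move=> d1; apply: query_bound.
  have -> : \sum_(k < d.+1) 'C(m, k)%:R * k%:R * (n%:R * log2 n%:R) =
      (size_work m (maxn 0 1) d.+1)%:R * (n%:R * log2 n%:R) :> R.
    (* The program starts at size 1; the term for size 0 vanishes by its factor [k]. *)
    rewrite -mulr_suml; congr (_ * _).
    rewrite max0n /size_work natr_sum big_add1 /= big_mkord big_ord_recl mulr0 add0r.
    by apply: eq_bigr => i _; rewrite natrM.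
  by apply: le_trans _ (time_bound _ _ (size_exp _ _ prod_n)); rewrite ler_nat.
(* [K] is at once a factor, at least [300 * (k.+1 * k) + 4] for the time and [k] for the queries,
   and an exponent, at least [k.+2]. *)
pose K := (300 * (k.+1 * k) + k + 4)%N; exists K => m A s a e sA aA dk ed.
have [t [ks [fnd ksd prod_n tl]]] := Learn_finds sA aA ed.
have A2 := size_exp _ _ prod_n.
exists t, (sumn ks); split=> //.
  set B := (m + #|A| + 1)%N.
  have szA : (size ks <= #|A|)%N by apply: leq_trans A2; apply/ltnW/ltn_expl.
  have B0 : (0 < B)%N by rewrite /B addn1.
  apply: (@leq_trans (K * B ^ k.+2)%N); last first.
    by rewrite leq_mul2l leq_pexp2l ?orbT // /K; lia.
  have W : (size_work m (maxn e 1) (ETD A).+1 <= k.+1 * k * B ^ k)%N.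
    apply: leq_trans (size_work_poly _ _ dk) _.
    rewrite [(_ * k)%N]mulnC mulnA leq_mul2l; apply/orP; right.
    by case: (k) => // k'; rewrite leq_exp2r // /B; lia.
  have Bk : (0 < B ^ k.+2)%N by rewrite expn_gt0 B0.
  have sAW : (size ks * (#|A| * size_work m (maxn e 1) (ETD A).+1) <=
      k.+1 * k * B ^ k.+2)%N.
    have nB : (#|A| <= B)%N by rewrite /B; lia.
    apply: (@leq_trans (B * (B * (k.+1 * k * B ^ k)))%N).
      by rewrite !leq_mul // (leq_trans szA).
    by rewrite !expnS; lia.
  by apply: leq_trans tl _; rewrite /K !mulnDl -mulnA; lia.
apply: leq_trans (sumn_le ksd) _; apply: leq_mul; first by rewrite /K; lia.
by rewrite -(@leq_exp2l 2) // (leq_trans A2) // leq_card_OPT.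
Qed.
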